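(* Let $p\ge3$ and $\lambda=\lambda_p=2\cos(\pi/p)$. The map sending a primitive hyperbolic conjugacy class $\mathcal C$ of $G_p$ to the irreducible system of poles $P_{\mathcal A}$, where $\mathcal A$ is the $G_p$-equivalence class of $\lambda$-BQFs containing $Q_M$ for $M\in\mathcal C$, is a one-to-one correspondence between primitive hyperbolic conjugacy classes of $G_p$ and ISPs for RPFs on $G_p$. In particular, if the class is represented by a generator product $$W=V_1^{m_1}V_{j_1}V_1^{m_2}V_{j_2}\cdots V_1^{m_\ell}V_{j_\ell},\qquad m_t\ge0,\ 2\le j_t\le p-1,$$ then the set of positive poles is $$\mathcal Z_{\mathcal A}=\{S^{-i}\beta_t:\ 1\le t\le\ell,\ 1\le i\le m_t+1\},$$ where $\beta_t$ is the number whose $\lambda$-CF is purely periodic with period $m_t+2,\underbrace{1,\dots,1}_{j_t-2},m_{t+1}+2,\underbrace{1,\dots,1}_{j_{t+1}-2},\dots,m_{t-1}+2,\underbrace{1,\dots,1}_{j_{t-1}-2}$ (indices taken cyclically mod $\ell$).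
   Context: Let $S=\begin{pmatrix}1&\lambda\\0&1\end{pmatrix}$, $T=\begin{pmatrix}0&-1\\1&0\end{pmatrix}$, $U=ST$, $G_p=\langle S,T\rangle/\{\pm I\}$ acting by Möbius transformations; elements are represented by matrices of positive trace. Hyperbolic: $|\mathrm{tr}|>2$; primitive: not a $k$-th power, $k\ge2$. Conjugacy class generators: $V_j=U^{j-1}S$, $1\le j\le p-1$; every non-elliptic element of $G_p$ is conjugate to a product of the $V_j$ unique up to cyclic permutation. A real number is hyperbolic if fixed by a hyperbolic element; its Hecke-conjugate $\alpha'$ is the other fixed point of the hyperbolic elements fixing $\alpha$. $\lambda$-continued fraction ($\lambda$-CF): for real $\alpha$ set $\alpha_0=\alpha$, $r_j=\lfloor\alpha_j/\lambda\rfloor+1$, $\alpha_{j+1}=1/(r_j\lambda-\alpha_j)$, and write $\alpha=[r_0;r_1,\dots]=r_0\lambda-\frac{1}{r_1\lambda-\cdots}$. A $\lambda$-BQF is $Q=[A,B,C]=Ax^2+Bxy+Cy^2$ with coefficients in $\mathbb Z[\lambda]$, with $G_p$-action $(Q\circ M)(x,y)=Q(ax+by,cx+dy)$ and the induced equivalence. For primitive hyperbolic $M=\begin{pmatrix}a&b\\c&d\end{pmatrix}$ of positive trace, $Q_M=[c,d-a,-b]$ (a hyperbolic form) and $\alpha_M=\frac{a-d+\sqrt{(a+d)^2-4}}{2c}$; for hyperbolic $\alpha$, $Q_\alpha=Q_{M_\alpha}$ where $M_\alpha$ is the primitive hyperbolic element with attracting fixed point $\alpha$. A hyperbolic number $\alpha$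 is simple if $\alpha'<0<\alpha$. For an equivalence class $\mathcal A$ of hyperbolic $\lambda$-BQFs, $\mathcal Z_{\mathcal A}=\{\alpha \text{ simple}: Q_\alpha\in\mathcal A\}$, and the irreducible system of poles (ISP) associated with $\mathcal A$ is $P_{\mathcal A}=\mathcal Z_{\mathcal A}\cup T\mathcal Z_{\mathcal A}$; these are exactly the minimal sets of nonzero poles forced to occur together in rational period functions (RPFs) on $G_p$, i.e. rational $q$ with $q+q|T=0$ and $\sum_{j=0}^{p-1}q|U^j=0$, where $(q|M)(z)=(cz+d)^{-2k}q(Mz)$. *)

(* Defs.v *)
From HB Require Import structures.
From mathcomp Require Import all_boot all_order all_algebra.
From mathcomp Require Import ring lra.
From mathcomp Require Import all_classical all_reals all_analysis.

Set Implicit Arguments.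
Unset Strict Implicit.
Unset Printing Implicit Defensive.

Import Order.TTheory GRing.Theory Num.Theory.
Import numFieldNormedType.Exports.
Local Open Scope classical_set_scope.
Local Open Scope ring_scope.

Definition mx2 (R : realType) (a b c d : R) : 'M[R]_2 :=
  \matrix_(i, j) if i == 0 then (if j == 0 then a else b)
                 else (if j == 0 then c else d).

Definition lam (R : realType) (p : nat) : R := 2 * cos (pi / p%:R).

Definition Smx (R : realType) (p : nat) : 'M[R]_2 := mx2 1 (lam R p) 0 1.
Definition Tmx (R : realType) : 'M[R]_2 := mx2 0 (-1) 1 0.
Definition Umx (R : realType) (p : nat) : 'M[R]_2 := Smx R p * Tmx R.
Definition Vmx (R : realType) (p j : nat) : 'M[R]_2 := Umx R p ^+ j.-1 * Smx R p.

(** The subgroup of SL(2, R) generated by S and T; G_p is its quotient by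
    {1, -1}. *)
Inductive Gamma (R : realType) (p : nat) : 'M[R]_2 -> Prop :=
| Gamma1 : Gamma p 1
| GammaS : Gamma p (Smx R p)
| GammaT : Gamma p (Tmx R)
| GammaM (M N : 'M[R]_2) : Gamma p M -> Gamma p N -> Gamma p (M * N)
| GammaV (M : 'M[R]_2) : Gamma p M -> Gamma p M^-1.

(** The element of G_p represented by the matrix M, as a coset of {1, -1};
    equality in G_p is equality of these cosets. *)
Definition pm (R : realType) (M : 'M[R]_2) : set 'M[R]_2 :=
  [set N | N = M \/ N = - M].

Definition mobius (R : realType) (M : 'M[R]_2) (z : R) : R :=
  (M 0 0 * z + M 0 1) / (M 1 0 * z + M 1 1).

(** The first conjunct excludes the pole of z |-> Mz, where the total division
    of [mobius] returns 0. *)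
Definition fixes (R : realType) (M : 'M[R]_2) (z : R) : Prop :=
  M 1 0 * z + M 1 1 != 0 /\ mobius M z = z.

Definition hyperbolic (R : realType) (p : nat) (M : 'M[R]_2) : Prop :=
  Gamma p M /\ 2 < `|\tr M|.

Definition is_power (R : realType) (p : nat) (M : 'M[R]_2) : Prop :=
  exists (N : 'M[R]_2) (k : nat),
    [/\ Gamma p N, (2 <= k)%N & pm M = pm (N ^+ k)].

Definition prim_hyp (R : realType) (p : nat) (M : 'M[R]_2) : Prop :=
  hyperbolic p M /\ ~ is_power p M.

(** Conjugacy classes of G_p, as sets of elements of G_p. *)
Definition conj_class (R : realType) (p : nat) (M : 'M[R]_2) :
    set (set 'M[R]_2) :=
  [set x | exists2 V, Gamma p V & x = pm (V * M * V^-1)].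

Definition prim_hyp_class (R : realType) (p : nat) : set (set (set 'M[R]_2)) :=
  [set C | exists2 M, prim_hyp p M & C = conj_class p M].

Definition hyperbolic_num (R : realType) (p : nat) (z : R) : Prop :=
  exists2 M, hyperbolic p M & fixes M z.

(** Meaningful when z is hyperbolic: the hyperbolic elements of G_p fixing z
    then share both of their fixed points. *)
Definition hecke_conj (R : realType) (p : nat) (z : R) : R :=
  xget 0 [set z' | z' != z /\
                   exists M, [/\ hyperbolic p M, fixes M z & fixes M z']].

Definition simple_num (R : realType) (p : nat) (z : R) : Prop :=
  hyperbolic_num p z /\ hecke_conj p z < 0 < z.

Definition attracting (R : realType) (M : 'M[R]_2) (z : R) : Prop :=
  fixes M z /\ `|derive1 (mobius M) z| < 1.

Definition alpha_mx (R : realType) (M : 'M[R]_2) : R :=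
  (M 0 0 - M 1 1 + Num.sqrt ((M 0 0 + M 1 1) ^+ 2 - 4)) / (2 * M 1 0).

(** The primitive hyperbolic element M_z with attracting fixed point z, given by
    its representative of positive trace. *)
Definition prim_mx (R : realType) (p : nat) (z : R) : 'M[R]_2 :=
  xget 0 [set M | [/\ prim_hyp p M, 0 < \tr M & attracting M z]].

(** The form [A, B, C] = A x^2 + B x y + C y^2. *)
Record bqf (R : realType) := Bqf { bqfA : R; bqfB : R; bqfC : R }.

Definition bqf_eval (R : realType) (Q : bqf R) (x y : R) : R :=
  bqfA Q * x ^+ 2 + bqfB Q * (x * y) + bqfC Q * y ^+ 2.

(** The coefficients of Q(a x + b y, c x + d y); see [bqf_actE]. *)
Definition bqf_act (R : realType) (Q : bqf R) (M : 'M[R]_2) : bqf R :=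
  let a := M 0 0 in let b := M 0 1 in let c := M 1 0 in let d := M 1 1 in
  Bqf (bqfA Q * a ^+ 2 + bqfB Q * (a * c) + bqfC Q * c ^+ 2)
      (2 * bqfA Q * (a * b) + bqfB Q * (a * d + b * c) + 2 * bqfC Q * (c * d))
      (bqfA Q * b ^+ 2 + bqfB Q * (b * d) + bqfC Q * d ^+ 2).

Lemma bqf_actE (R : realType) (Q : bqf R) (M : 'M[R]_2) (x y : R) :
  bqf_eval (bqf_act Q M) x y =
  bqf_eval Q (M 0 0 * x + M 0 1 * y) (M 1 0 * x + M 1 1 * y).
Proof. by rewrite /bqf_eval /bqf_act /=; ring. Qed.

Definition in_Zlam (R : realType) (p : nat) (x : R) : Prop :=
  exists q : {poly int}, x = (map_poly intr q).[lam R p].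

Definition lambda_bqf (R : realType) (p : nat) (Q : bqf R) : Prop :=
  [/\ in_Zlam p (bqfA Q), in_Zlam p (bqfB Q) & in_Zlam p (bqfC Q)].

Definition bqf_class (R : realType) (p : nat) (Q : bqf R) : set (bqf R) :=
  [set Q' | lambda_bqf p Q' /\ exists2 V, Gamma p V & Q' = bqf_act Q V].

Definition Qmx (R : realType) (M : 'M[R]_2) : bqf R :=
  Bqf (M 1 0) (M 1 1 - M 0 0) (- M 0 1).

Definition Qnum (R : realType) (p : nat) (z : R) : bqf R := Qmx (prim_mx p z).

Definition hyperbolic_bqf (R : realType) (p : nat) (Q : bqf R) : Prop :=
  lambda_bqf p Q /\ exists M, [/\ prim_hyp p M, 0 < \tr M & Q = Qmx M].

Definition hyperbolic_bqf_class (R : realType) (p : nat) : set (set (bqf R)) :=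
  [set A | exists2 Q, hyperbolic_bqf p Q & A = bqf_class p Q].

Definition Zset (R : realType) (p : nat) (A : set (bqf R)) : set R :=
  [set z | simple_num p z /\ A (Qnum p z)].

Definition Pset (R : realType) (p : nat) (A : set (bqf R)) : set R :=
  Zset p A `|` mobius (Tmx R) @` Zset p A.

Definition isp (R : realType) (p : nat) : set (set R) :=
  [set P | exists2 A, hyperbolic_bqf_class p A & P = Pset p A].

(** The class of forms attached to a conjugacy class C: everything equivalent to
    Q_M for some M of positive trace representing an element of C. *)
Definition forms_of (R : realType) (p : nat) (C : set (set 'M[R]_2)) :
    set (bqf R) :=
  [set Q | exists M, [/\ C (pm M), 0 < \tr M & bqf_class p (Qmx M) Q]].

Fixpoint lcf_tail (R : realType) (p : nat) (z : R) (n : nat) : R :=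
  if n is n'.+1 then
    let zn := lcf_tail p z n' in
    ((Num.floor (zn / lam R p) + 1)%:~R * lam R p - zn)^-1
  else z.

Definition lcf_digit (R : realType) (p : nat) (z : R) (n : nat) : int :=
  Num.floor (lcf_tail p z n / lam R p) + 1.

Definition lcf_purely_periodic (R : realType) (p : nat) (z : R)
    (s : seq nat) : Prop :=
  (0 < size s)%N /\
  forall n : nat, lcf_digit p z n = (nth 0%N s (n %% size s))%:Z.

(** A sequence w of pairs (m_t, j_t) encodes the generator product
    V_1^m_1 V_j_1 ... V_1^m_l V_j_l, with t counted from 0. *)
Definition gen_word (p : nat) (w : seq (nat * nat)) : Prop :=
  (0 < size w)%N /\ all (fun mj => (2 <= mj.2 <= p.-1)%N) w.

Definition gen_prod (R : realType) (p : nat) (w : seq (nat * nat)) : 'M[R]_2 :=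
  \prod_(mj <- w) (Vmx R p 1 ^+ mj.1 * Vmx R p mj.2).

Definition cf_period (w : seq (nat * nat)) : seq nat :=
  flatten [seq mj.1.+2 :: nseq (mj.2 - 2) 1%N | mj <- w].

(** beta is the sequence of the numbers beta_t: its t-th term is the unique
    number with period starting at the t-th pair and read cyclically. *)
Definition is_beta (R : realType) (p : nat) (w : seq (nat * nat))
    (beta : nat -> R) : Prop :=
  forall t : nat, (t < size w)%N ->
    forall z : R, lcf_purely_periodic p z (cf_period (rot t w)) <-> z = beta t.

Definition shifted_betas (R : realType) (p : nat) (w : seq (nat * nat))
    (beta : nat -> R) : set R :=
  [set z | exists t i : nat,
    [/\ (t < size w)%N, (1 <= i <= (nth (0%N, 0%N) w t).1.+1)%N
      & z = mobius (Smx R p ^- i) (beta t)]].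

(** [attracting] agrees with the closed formula for the attracting fixed point
    of a hyperbolic matrix of positive trace. *)
Lemma attractingE (R : realType) (M : 'M[R]_2) (z : R) :
  M 0 0 * M 1 1 - M 0 1 * M 1 0 = 1 -> 2 < M 0 0 + M 1 1 -> M 1 0 != 0 ->
  attracting M z <-> z = alpha_mx M.
Proof.
rewrite /attracting /fixes /mobius /alpha_mx.
move: (M 0 0) (M 0 1) (M 1 0) (M 1 1) => a b c d detM trM c0.
have D0 : 0 < (a + d) ^+ 2 - 4 by nra.
have s0 := D0; rewrite -sqrtr_gt0 in s0.
have ss := sqr_sqrtr (ltW D0).
move: s0 ss; set s := Num.sqrt _ => s0 ss.
have derE : c * z + d != 0 ->
    derive1 (fun x => (a * x + b) / (c * x + d)) z = ((c * z + d) ^+ 2)^-1.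
  move=> e0; rewrite derive1E.
  have dd : is_derive z 1 (fun x => c * x + d) c.
    have := is_deriveD (is_deriveZ c (is_derive_id z 1)) (is_derive_cst d z 1).
    by rewrite /GRing.scale /= mulr1 addr0.
  have dn : is_derive z 1 (fun x => a * x + b) a.
    have := is_deriveD (is_deriveZ a (is_derive_id z 1)) (is_derive_cst b z 1).
    by rewrite /GRing.scale /= mulr1 addr0.
  have -> : (fun x => (a * x + b) / (c * x + d)) =
    (fun x => a * x + b) * (fun y => (c * y + d)^-1) by [].
  have dV : derivable (fun y => (c * y + d)^-1) z 1 by apply: derivableV.
  rewrite deriveM //.
  rewrite deriveV // !derive_val /GRing.scale /=.
  rewrite -[RHS]mul1r -detM; by field.
split=> [[[e0 fz] az]|zE].
- rewrite derE // in az.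
  have q : c * z ^+ 2 + (d - a) * z - b = 0.
    have := congr1 (fun x => x * (c * z + d)) fz.
    by rewrite /= divfK // => h; lra.
  move: az; rewrite normfV normrX -exprVn expr_lt1 ?invr_ge0 //.
  rewrite invf_lt1 ?normr_gt0 // => az.
  have : (2 * c * z - (a - d) - s) * (2 * c * z - (a - d) + s) = 0.
    rewrite -subr_sqr ss.
    transitivity (4 * c * (c * z ^+ 2 + (d - a) * z - b)
                  - 4 * (a * d - b * c - 1)); first by ring.
    by rewrite q detM; ring.
  move/eqP; rewrite mulf_eq0 => /orP[] /eqP h.
    apply/eqP; rewrite eq_sym -subr_eq0; apply/eqP.
    rewrite (_ : s = 2 * c * z - (a - d)); last lra.
    by field.
  exfalso; have h' : c * z + d = (a + d - s) / 2 by lra.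
  have lo : 0 < (a + d - s) / 2 by nra.
  have hi : (a + d - s) / 2 < 1 by nra.
  by move: az; rewrite h' gtr0_norm // => az; lra.
- have h' : c * z + d = (a + d + s) / 2 by rewrite zE; field.
  have hi : 1 < (a + d + s) / 2 by lra.
  have e0 : c * z + d != 0 by rewrite h'; apply: lt0r_neq0; lra.
  split; first split=> //.
    apply: (mulIf e0); rewrite divfK //.
    have q : 4 * c * (z * (c * z + d) - (a * z + b)) = 0.
      transitivity ((2 * c * z - (a - d)) ^+ 2 - s ^+ 2
        + 4 * (a * d - b * c - 1) + (s ^+ 2 - ((a + d) ^+ 2 - 4))); first by ring.
      rewrite detM ss (_ : 2 * c * z - (a - d) = s); last by rewrite zE; field.
      by rewrite ss; ring.
    move/eqP: q; rewrite !mulf_eq0 (negbTE c0) pnatr_eq0 /= subr_eq0.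
    by move/eqP.
  rewrite derE // normfV normrX -exprVn expr_lt1 ?invr_ge0 //.
  by rewrite invf_lt1 ?normr_gt0 // h' gtr0_norm // (lt_trans ltr01).
Qed.

(* Main.v *)
Require Import Defs.
From mathcomp Require Import all_boot all_order all_algebra.
From mathcomp Require Import ring lra zify.
From mathcomp Require Import all_classical all_reals all_analysis.

(** With s_j = sin(j pi/p) / sin(pi/p), the matrix
    V_j = [[s_j, s_(j+1)], [s_(j-1), s_j]] has nonnegative entries for 1 <= j < p, and
    the images of the positive half-line under V_1, ..., V_(p-1) are disjoint.  Hence
    the V_j freely generate a monoid, which by the normal form
    +-T^e V_(j_1) ... V_(j_n) T^e' contains all the elements of G_p with positive entries.

    A hyperbolic M of positive trace with attracting fixed point z and other fixed
    point z' satisfies z' < 0 < z exactly when all its entries are positive.  So the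
    points of Z_A are the attracting fixed points of the positive conjugates of M.
    Cyclic reduction shows that there is at least one, and any two of them are cyclic
    permutations of each other as words.  Discreteness enters only through the
    following fact: if N in G_p fixes a positive point z fixed by a word W, then N W^k
    is a word for large k, up to sign, and words fixing the same positive point commute;
    so N commutes with W and fixes the other fixed point of W too.  Commuting words are
    powers of a common word, which gives the uniqueness of the primitive M_z, so that
    every point of Z_A determines the conjugacy class.

    Finally S^(m+2) T (S T)^(j-2) = S (S^m V_j) S^(-1), so beta_t is the translate by
    lambda of the fixed point of the t-th rotation of the generator product. *)

Set Implicit Arguments.
Unset Strict Implicit.
Unset Printing Implicit Defensive.

Import Order.TTheory GRing.Theory Num.Theory.
Local Open Scope classical_set_scope.
Local Open Scope ring_scope.

(** * Two by two matrices *)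

Lemma ord2P (i : 'I_2) : i = 0 \/ i = 1.
Proof. by case: i => [[|[|]]] // lt; [left | right]; apply: val_inj. Qed.

Lemma matrix22P (T : Type) (M N : 'M[T]_2) :
  M 0 0 = N 0 0 -> M 0 1 = N 0 1 -> M 1 0 = N 1 0 -> M 1 1 = N 1 1 -> M = N.
Proof.
move=> e00 e01 e10 e11; apply/matrixP=> i j.
by case: (ord2P i) => ->; case: (ord2P j) => ->.
Qed.

Lemma colv2P (T : Type) (u v : 'cV[T]_2) : u 0 0 = v 0 0 -> u 1 0 = v 1 0 -> u = v.
Proof. by move=> e0 e1; apply/colP=> i; case: (ord2P i) => ->. Qed.

Lemma big_ord2 (V : nmodType) (F : 'I_2 -> V) : \sum_i F i = F 0 + F 1.
Proof.
by rewrite !big_ord_recl big_ord0 addr0; congr (_ + F _); apply: val_inj.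
Qed.

Lemma mulmx_ord2E (K : pzRingType) m n (M : 'M[K]_(m, 2)) (N : 'M[K]_(2, n)) i j :
  (M *m N) i j = M i 0 * N 0 j + M i 1 * N 1 j.
Proof. by rewrite mxE big_ord2. Qed.

Lemma mxtrace_mx22 (V : nmodType) (M : 'M[V]_2) : \tr M = M 0 0 + M 1 1.
Proof. exact: big_ord2. Qed.

Lemma det_mx22 (K : comNzRingType) (M : 'M[K]_2) :
  \det M = M 0 0 * M 1 1 - M 0 1 * M 1 0.
Proof.
rewrite (expand_det_row _ 0) big_ord2 /cofactor !det_mx11 !mxE /=.
rewrite expr0 mul1r expr1 mulN1r mulrN.
by congr (_ * M _ _ - _ * M _ _); apply: val_inj.
Qed.

Lemma det1_unit (K : comUnitRingType) n (M : 'M[K]_n.+1) :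
  \det M = 1 -> M \is a GRing.unit.
Proof. by move=> detM; suff: M \in unitmx by []; rewrite unitmxE detM unitr1. Qed.

Lemma det1X (K : comNzRingType) n (M : 'M[K]_n.+1) k :
  \det M = 1 -> \det (M ^+ k) = 1.
Proof.
move=> detM; elim: k => [|k IH]; first by rewrite expr0 det1.
by rewrite exprS det_mulmx detM IH mulr1.
Qed.

Lemma mxtrace_conj (K : comUnitRingType) n (A M : 'M[K]_n.+1) :
  A \is a GRing.unit -> \tr (A * M * A^-1) = \tr M.
Proof. by move=> uA; rewrite -[LHS]mxtrace_mulC mulmxE mulrA mulVr // mul1r. Qed.

Section Mx2.
Variable R : realType.
Implicit Types (a b c d x y z : R) (M N A : 'M[R]_2).

Lemma mx2E a b c d : ((mx2 a b c d 0 0 = a) * (mx2 a b c d 0 1 = b)) *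
  ((mx2 a b c d 1 0 = c) * (mx2 a b c d 1 1 = d)).
Proof. by rewrite !mxE. Qed.

Lemma mx2_eta M : M = mx2 (M 0 0) (M 0 1) (M 1 0) (M 1 1).
Proof. by apply: matrix22P; rewrite mx2E. Qed.

Lemma mx2M a b c d a' b' c' d' : mx2 a b c d * mx2 a' b' c' d' =
  mx2 (a * a' + b * c') (a * b' + b * d') (c * a' + d * c') (c * b' + d * d').
Proof. by apply: matrix22P; rewrite mulmx_ord2E !mx2E. Qed.

Lemma mx2N a b c d : - mx2 a b c d = mx2 (- a) (- b) (- c) (- d).
Proof. by apply: matrix22P; rewrite !mxE. Qed.

Lemma mx2_1 : 1 = mx2 1 0 0 1 :> 'M[R]_2.
Proof. by apply: matrix22P; rewrite !mxE. Qed.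

Lemma det1_inv M : \det M = 1 -> M^-1 = mx2 (M 1 1) (- M 0 1) (- M 1 0) (M 0 0).
Proof.
move=> detM; apply: (mulrI (det1_unit detM)); rewrite mulrV ?det1_unit //.
rewrite {1}[M]mx2_eta mx2M mx2_1 -detM det_mx22.
by congr mx2; ring.
Qed.

Lemma pmP M N : pm M = pm N <-> pm M N.
Proof.
split=> [->|]; first by left.
by case=> ->; apply/seteqP; split=> x [] ->;
  rewrite /pm /= ?opprK; by [left | right].
Qed.

Lemma pm_refl M : pm M M. Proof. by left. Qed.

Lemma pmN M : pm M (- M). Proof. by right. Qed.

Lemma pm_sym M N : pm M N -> pm N M.
Proof. by case=> ->; [left | right; rewrite opprK]. Qed.

Lemma pm_trans M N A : pm M N -> pm N A -> pm M A.
Proof. by case=> ->; case=> ->; rewrite ?opprK; [left | right | right | left]. Qed.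

Lemma pmM M N M' N' : pm M M' -> pm N N' -> pm (M * N) (M' * N').
Proof.
by case=> ->; case=> ->; rewrite ?mulrN ?mulNr ?opprK; [left | right | right | left].
Qed.

Lemma pm_norm_trace M N : pm M N -> `|\tr N| = `|\tr M|.
Proof. by case=> -> //; rewrite raddfN normrN. Qed.

(** * Fixed points *)

Lemma opposite_neq z z' : z' < 0 < z -> z' != z.
Proof. by case/andP=> z'0 z0; rewrite lt_eqF // (lt_trans z'0). Qed.

Definition cv2 x y : 'cV[R]_2 := \col_i (if i == 0 then x else y).

Lemma cv2E x y : (cv2 x y 0 0 = x) * (cv2 x y 1 0 = y).
Proof. by rewrite !mxE. Qed.

Lemma fixes_eigen M z : fixes M z -> M *m cv2 z 1 = (M 1 0 * z + M 1 1) *: cv2 z 1.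
Proof.
case=> den0 fixz; apply: colv2P; rewrite mulmx_ord2E !mxE /= !mulr1 //.
by rewrite -[X in _ = _ * X]fixz /mobius [RHS]mulrC divfK.
Qed.

Lemma eigen_fixes M z mu : mu != 0 -> M *m cv2 z 1 = mu *: cv2 z 1 -> fixes M z.
Proof.
move=> mu0 /matrixP eq; have := eq 0 0; have := eq 1 0.
rewrite !mulmx_ord2E !mxE /= !mulr1 => e1 e0; rewrite /fixes /mobius e1 e0.
by split=> //; rewrite mulrAC divff // mul1r.
Qed.

Lemma fixes1 z : fixes (1 : 'M[R]_2) z.
Proof. by apply: (@eigen_fixes _ _ 1); rewrite ?oner_eq0 // mul1mx scale1r. Qed.

Lemma fixesM M N z : fixes M z -> fixes N z -> fixes (M * N) z.
Proof.
move=> fM fN; have [[M0 _] [N0 _]] := (fM, fN).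
apply: (eigen_fixes (mulf_neq0 N0 M0)).
by rewrite -mulmxE -mulmxA (fixes_eigen fN) -scalemxAr (fixes_eigen fM) scalerA.
Qed.

Lemma fixesX M z n : fixes M z -> fixes (M ^+ n) z.
Proof.
by move=> fM; elim: n => [|n IH]; [exact: fixes1 | rewrite exprS; exact: fixesM].
Qed.

Lemma fixes_pm M N z : pm M N -> fixes M z -> fixes N z.
Proof.
case=> -> // fM; have [den0 _] := fM.
apply: (@eigen_fixes _ _ (- (M 1 0 * z + M 1 1))); first by rewrite oppr_eq0.
by rewrite mulNmx fixes_eigen // scaleNr.
Qed.

Lemma fixesV M z : M \is a GRing.unit -> fixes M z -> fixes M^-1 z.
Proof.
move=> uM fM; have [den0 _] := fM.
apply: (eigen_fixes (invr_neq0 den0)); apply: (scalerI den0).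
rewrite scalerA divff // scale1r scalemxAr -fixes_eigen // mulmxA mulmxE.
by rewrite mulVr // mul1mx.
Qed.

Lemma fixes_quadratic M z : fixes M z ->
  M 1 0 * z ^+ 2 + (M 1 1 - M 0 0) * z - M 0 1 = 0.
Proof.
move/fixes_eigen/matrixP => /(_ 0 0); rewrite mulmx_ord2E !mxE /= => e.
lra.
Qed.

Lemma quadratic_fixes M z : \det M != 0 ->
  M 1 0 * z ^+ 2 + (M 1 1 - M 0 0) * z - M 0 1 = 0 -> fixes M z.
Proof.
rewrite det_mx22 => det0 quad.
have num : M 0 0 * z + M 0 1 = (M 1 0 * z + M 1 1) * z by lra.
have den0 : M 1 0 * z + M 1 1 != 0.
  apply: contra_neq det0 => den; rewrite den mul0r in num.
  have [-> ->] : M 0 1 = - (M 0 0 * z) /\ M 1 1 = - (M 1 0 * z) by split; lra.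
  by ring.
by split=> //; rewrite /mobius num mulrAC divff // mul1r.
Qed.

Lemma fixes_vieta M z z' : fixes M z -> fixes M z' -> z' != z ->
  M 1 0 * (z + z') = M 0 0 - M 1 1 /\ M 1 0 * (z * z') = - M 0 1.
Proof.
move=> /fixes_quadratic quad /fixes_quadratic quad' zz'.
have sum : M 1 0 * (z + z') = M 0 0 - M 1 1.
  by apply: (mulfI (_ : z' - z != 0)); [rewrite subr_eq0 | lra].
split=> //; transitivity (z * (M 1 0 * (z + z')) - M 1 0 * z ^+ 2); first by ring.
by rewrite sum; lra.
Qed.

Lemma fixes_conj_root M z : \det M != 0 -> M 1 0 != 0 -> z != 0 -> fixes M z ->
  fixes M (- M 0 1 / (M 1 0 * z)).
Proof.
move=> det0 c0 z0 /fixes_quadratic quad; apply: quadratic_fixes => //.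
transitivity ((- M 0 1 / (M 1 0 * z ^+ 2)) *
  (M 1 0 * z ^+ 2 + (M 1 1 - M 0 0) * z - M 0 1)); first by field; apply/andP.
by rewrite quad mulr0.
Qed.

Lemma comm_fixes M N z : \det N != 0 -> M * N = N * M -> M 1 0 != 0 ->
  fixes M z -> fixes N z.
Proof.
move=> det0 /matrixP comm c0 /fixes_quadratic quad; apply: quadratic_fixes => //.
have e00 := comm 0 0; have e10 := comm 1 0.
rewrite !mulmx_ord2E in e00 e10; apply: (mulfI c0); rewrite mulr0.
have -> : M 1 0 * (N 1 0 * z ^+ 2 + (N 1 1 - N 0 0) * z - N 0 1) =
    N 1 0 * (M 1 0 * z ^+ 2 + (M 1 1 - M 0 0) * z - M 0 1)
    + (M 1 0 * (N 1 1 - N 0 0) - N 1 0 * (M 1 1 - M 0 0)) * z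
    + (N 1 0 * M 0 1 - M 1 0 * N 0 1) by ring.
have -> : M 1 0 * (N 1 1 - N 0 0) - N 1 0 * (M 1 1 - M 0 0) = 0 by lra.
by rewrite quad; lra.
Qed.

Lemma distinct_fixes_neq0 M z z' : \det M = 1 -> 2 < `|\tr M| ->
  fixes M z -> fixes M z' -> z' != z -> M 1 0 != 0.
Proof.
move=> detM trM fz fz' zz'; have [sum prod] := fixes_vieta fz fz' zz'.
apply/eqP=> c0; move: detM trM sum prod; rewrite det_mx22 mxtrace_mx22 c0 !mul0r.
move=> detM trM ad _; have adE : M 1 1 = M 0 0 by lra.
rewrite adE mulr0 subr0 in detM trM.
have [a0|a0] := leP 0 (M 0 0); first by rewrite ger0_norm in trM; nra.
by rewrite ltr0_norm in trM; nra.
Qed.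

Lemma attracting_alphaP M z : \det M = 1 -> 2 < \tr M -> M 1 0 != 0 ->
  attracting M z <-> z = alpha_mx M.
Proof. by rewrite det_mx22 mxtrace_mx22; apply: attractingE. Qed.

Lemma alpha_fixes M : \det M = 1 -> 2 < \tr M -> M 1 0 != 0 -> fixes M (alpha_mx M).
Proof. by move=> detM trM c0; case: ((attracting_alphaP _ detM trM c0).2 erefl). Qed.

(** * Nonnegative matrices *)

Definition posv (u : 'cV[R]_2) := 0 < u 0 0 /\ 0 < u 1 0.

Lemma posv_cv2 z : 0 < z -> posv (cv2 z 1).
Proof. by move=> z0; rewrite /posv !cv2E. Qed.

Definition nonneg_diag_ge1 M := [/\ 1 <= M 0 0, 0 <= M 0 1, 0 <= M 1 0 & 1 <= M 1 1].

Lemma nonneg_diag_ge1_1 : nonneg_diag_ge1 1.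
Proof. by rewrite mx2_1 /nonneg_diag_ge1 !mx2E. Qed.

Lemma nonneg_diag_ge1M M N :
  nonneg_diag_ge1 M -> nonneg_diag_ge1 N -> nonneg_diag_ge1 (M * N).
Proof.
rewrite /nonneg_diag_ge1 => -[a1 b0 c0 d1] [a1' b0' c0' d1'].
by rewrite !mulmx_ord2E; split; nra.
Qed.

Lemma nonneg_diag_ge1X M n : nonneg_diag_ge1 M -> nonneg_diag_ge1 (M ^+ n).
Proof.
move=> nM; elim: n => [|n IH]; first exact: nonneg_diag_ge1_1.
by rewrite exprS; apply: nonneg_diag_ge1M.
Qed.

Lemma nonneg_diag_ge1_posv M u : nonneg_diag_ge1 M -> posv u -> posv (M *m u).
Proof. by move=> [a1 b0 c0 d1] [u0 u1]; rewrite /posv !mulmx_ord2E; split; nra. Qed.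

Lemma nonneg_Tmx_not_fixes M z : nonneg_diag_ge1 M -> 0 < z ->
  ~ fixes (Tmx R * M) z.
Proof.
move=> [a1 b0 c0 d1] z0 /fixes_quadratic; rewrite !mulmx_ord2E !mx2E.
have : 0 <= M 0 0 * z ^+ 2 by rewrite mulr_ge0 ?sqr_ge0 //; lra.
have := mulr_ge0 b0 (ltW z0); have := mulr_ge0 c0 (ltW z0).
lra.
Qed.

Lemma nonneg_den_gt0 M x : nonneg_diag_ge1 M -> 0 <= x -> 0 < M 1 0 * x + M 1 1.
Proof. by move=> [a1 b0 c0 d1] x0; have := mulr_ge0 c0 x0; lra. Qed.

Lemma mobius1 x : mobius (1 : 'M[R]_2) x = x.
Proof. by rewrite mx2_1 /mobius !mx2E mul0r add0r divr1 mul1r addr0. Qed.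

Lemma mobiusM M N x : N 1 0 * x + N 1 1 != 0 ->
  mobius (M * N) x = mobius M (mobius N x).
Proof.
move=> den0; rewrite /mobius !mulmx_ord2E; set den := _ + N 1 1 in den0 *.
set y := (N 0 0 * x + N 0 1) / den.
have -> : (M 0 0 * N 0 0 + M 0 1 * N 1 0) * x + (M 0 0 * N 0 1 + M 0 1 * N 1 1) =
    den * (M 0 0 * y + M 0 1) by rewrite /y /den; field.
have -> : (M 1 0 * N 0 0 + M 1 1 * N 1 0) * x + (M 1 0 * N 0 1 + M 1 1 * N 1 1) =
    den * (M 1 0 * y + M 1 1) by rewrite /y /den; field.
by rewrite -mulf_div divff // mul1r.
Qed.

Lemma nonneg_mobiusM M N x : nonneg_diag_ge1 N -> 0 <= x ->
  mobius (M * N) x = mobius M (mobius N x).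
Proof. by move=> nN x0; rewrite mobiusM // gt_eqF // nonneg_den_gt0. Qed.

Lemma nonneg_mobius_ge0 M x : nonneg_diag_ge1 M -> 0 <= x -> 0 <= mobius M x.
Proof.
move=> nM x0; have den0 := nonneg_den_gt0 nM x0; have [a1 b0 c0 d1] := nM.
by rewrite divr_ge0 ?(ltW den0) // addr_ge0 // mulr_ge0 //; lra.
Qed.

Lemma nonneg_mobius_gt0 M x : nonneg_diag_ge1 M -> 0 < x -> 0 < mobius M x.
Proof.
move=> nM x0; have den0 := nonneg_den_gt0 nM (ltW x0); have [a1 b0 c0 d1] := nM.
by rewrite divr_gt0 // ltr_wpDr // mulr_gt0 //; lra.
Qed.

Lemma nonneg_mobius_contract M x y : nonneg_diag_ge1 M -> \det M = 1 ->
  0 <= x -> 0 <= y -> M 1 0 * `|mobius M x - mobius M y| <= 1.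
Proof.
move=> nM detM x0 y0; have [a1 b0 c0 d1] := nM.
have denx := nonneg_den_gt0 nM x0; have deny := nonneg_den_gt0 nM y0.
have -> : mobius M x - mobius M y =
    (x - y) / ((M 1 0 * x + M 1 1) * (M 1 0 * y + M 1 1)).
  by rewrite -[x - y]mul1r -detM det_mx22 /mobius; field; rewrite !gt_eqF.
have den0 := mulr_gt0 denx deny.
rewrite normrM normfV (gtr0_norm den0) mulrA ler_pdivrMr // mul1r.
have le_xy : `|x - y| <= x + y by rewrite ler_norml; apply/andP; split; lra.
have cx := mulr_ge0 c0 x0; have cy := mulr_ge0 c0 y0.
have := ler_wpM2l c0 le_xy; have := mulr_ge0 cx cy.
by nra.
Qed.

Lemma nonneg_expr_lower_ge M n : nonneg_diag_ge1 M -> n%:R * M 1 0 <= (M ^+ n) 1 0.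
Proof.
move=> nM; elim: n => [|n IH]; first by rewrite expr0 mx2_1 !mx2E mul0r.
have [a1 b0 c0 d1] := nM; have [a1' b0' c0' d1'] := nonneg_diag_ge1X n nM.
by rewrite exprS mulmx_ord2E -natr1; nra.
Qed.

Lemma mobius_expr_images_eq M x z : nonneg_diag_ge1 M -> \det M = 1 -> 0 < M 1 0 ->
  0 <= z -> mobius M z = z ->
  (forall n, exists2 y, 0 <= y & x = mobius (M ^+ n) y) -> x = z.
Proof.
move=> nM detM c0 z0 fixz xE.
have fixXz n : mobius (M ^+ n) z = z.
  elim: n => [|n IH]; first by rewrite expr0 mobius1.
  by rewrite exprS nonneg_mobiusM ?IH //; apply: nonneg_diag_ge1X.
apply/eqP/negPn/negP; rewrite -subr_eq0 -normr_gt0 => dist0.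
have bound n : n%:R * (M 1 0 * `|x - z|) <= 1.
  have [y y0 xEn] := xE n.
  have := nonneg_mobius_contract (nonneg_diag_ge1X n nM) (det1X n detM) y0 z0.
  rewrite -xEn fixXz mulrA; apply: le_trans.
  by rewrite ler_wpM2r // nonneg_expr_lower_ge.
have k0 : 0 < M 1 0 * `|x - z| by rewrite mulr_gt0.
have := bound (Num.bound (M 1 0 * `|x - z|)^-1).
have := @archi_boundP _ (M 1 0 * `|x - z|)^-1.
rewrite invr_ge0 (ltW k0) => /(_ isT); rewrite -(ltr_pM2r k0) mulVf ?gt_eqF //.
by lra.
Qed.

Definition posmx M := [/\ 0 < M 0 0, 0 < M 0 1, 0 < M 1 0 & 0 < M 1 1].

Lemma nonneg_diag_ge1_posmx M : \det M = 1 -> 2 < \tr M -> nonneg_diag_ge1 M ->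
  posmx M.
Proof.
rewrite det_mx22 mxtrace_mx22 => detM trM [a1 b0 c0 d1].
have bc0 : 0 < M 0 1 * M 1 0 by nra.
have [b_neq0 c_neq0] : M 0 1 != 0 /\ M 1 0 != 0.
  by apply/andP; rewrite -negb_or -mulf_eq0 gt_eqF.
by split; rewrite ?lt_neqAle 1?eq_sym ?b_neq0 ?c_neq0 //; lra.
Qed.

Lemma posmx_neq0 M : posmx M -> M 1 0 != 0.
Proof. by case=> _ _ c0 _; rewrite gt_eqF. Qed.

Lemma posmx_trace_gt0 M : posmx M -> 0 < \tr M.
Proof. by case=> a0 _ _ d0; rewrite mxtrace_mx22 addr_gt0. Qed.

Lemma alpha_gt0 M : \det M = 1 -> 2 < \tr M -> posmx M -> 0 < alpha_mx M.
Proof.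
rewrite det_mx22 mxtrace_mx22 => detM trM [a0 b0 c0 d0].
have bc0 : 0 < M 0 1 * M 1 0 by rewrite mulr_gt0.
have disc0 : 0 < (M 0 0 + M 1 1) ^+ 2 - 4 by nra.
have s0 : 0 < Num.sqrt ((M 0 0 + M 1 1) ^+ 2 - 4) by rewrite sqrtr_gt0.
have ss := sqr_sqrtr (ltW disc0).
by rewrite divr_gt0 ?mulr_gt0 //; nra.
Qed.

Lemma posmx_fixes_lt0 M : \det M = 1 -> 2 < \tr M -> posmx M ->
  exists2 z, z < 0 & fixes M z.
Proof.
move=> detM trM pM; have al0 := alpha_gt0 detM trM pM.
have [_ b0 c0 _] := pM; exists (- M 0 1 / (M 1 0 * alpha_mx M)).
  by rewrite mulNr oppr_lt0 divr_gt0 // mulr_gt0.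
apply: fixes_conj_root; rewrite ?detM ?oner_eq0 ?gt_eqF //.
by apply: alpha_fixes; rewrite ?gt_eqF.
Qed.

Lemma opposite_fixes_posmx M z z' : \det M = 1 -> 0 < \tr M -> 0 < M 1 0 ->
  z' < 0 < z -> fixes M z -> fixes M z' -> posmx M.
Proof.
rewrite det_mx22 mxtrace_mx22 => detM trM c0 opp fz fz'.
have [_ prod] := fixes_vieta fz fz' (opposite_neq opp); have /andP[z'0 z0] := opp.
have b0 : 0 < M 0 1 by rewrite -oppr_lt0 -prod !pmulr_rlt0.
have bc0 : 0 < M 0 1 * M 1 0 by rewrite mulr_gt0.
by split=> //; nra.
Qed.

Lemma opposite_fixes_posmxV M z z' : \det M = 1 -> 2 < \tr M ->
  z' < 0 < z -> fixes M z -> fixes M z' -> posmx M \/ posmx M^-1.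
Proof.
move=> detM trM opp fz fz'; have uM := det1_unit detM.
have trM0 : 0 < \tr M by lra.
have : M 1 0 != 0.
  by apply: distinct_fixes_neq0 fz fz' (opposite_neq opp); rewrite ?gtr0_norm.
rewrite neq_lt => /orP[c0|c0]; last by left; apply: opposite_fixes_posmx fz fz'.
right; apply: (opposite_fixes_posmx (z := z) (z' := z')) => //; try exact: fixesV.
- by rewrite detV detM invr1.
- by rewrite det1_inv // mxtrace_mx22 !mx2E addrC -mxtrace_mx22.
- by rewrite det1_inv // !mx2E oppr_gt0.
Qed.

Lemma alpha_opposite_posmx M z' : \det M = 1 -> 2 < \tr M -> M 1 0 != 0 ->
  fixes M z' -> z' < 0 < alpha_mx M -> posmx M.
Proof.
move=> detM trM c0 fz' opp; have fal := alpha_fixes detM trM c0.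
have lt : z' < alpha_mx M by case/andP: opp; apply: lt_trans.
apply: (opposite_fixes_posmx (z := alpha_mx M) (z' := z')) => //; first by lra.
have [sum _] := fixes_vieta fal fz' (opposite_neq opp).
set s := Num.sqrt ((M 0 0 + M 1 1) ^+ 2 - 4).
have s0 : 0 < s by rewrite sqrtr_gt0; move: trM; rewrite mxtrace_mx22; nra.
have alE : 2 * M 1 0 * alpha_mx M = M 0 0 - M 1 1 + s by rewrite /alpha_mx -/s; field.
have : 0 < M 1 0 * (alpha_mx M - z').
  by rewrite (_ : _ * (_ - _) = s) //; lra.
by rewrite pmulr_lgt0 // subr_gt0.
Qed.

Lemma posmx_eigen_posv M u mu : posmx M -> posv u -> M *m u = mu *: u ->
  \tr M < 2 * mu.
Proof.
move=> [_ b0 c0 _] [u0 u1] /matrixP eigen; have := eigen 0 0; have := eigen 1 0.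
rewrite !mulmx_ord2E mxtrace_mx22 !mxE => e1 e0.
have lt0 : M 0 0 < mu by rewrite -(ltr_pM2r u0) -e0 ltrDl mulr_gt0.
have lt1 : M 1 1 < mu by rewrite -(ltr_pM2r u1) -e1 ltrDr mulr_gt0.
lra.
Qed.

Lemma posmx_eigen_Tposv M u mu : posmx M -> posv u ->
  M *m (Tmx R *m u) = mu *: (Tmx R *m u) -> 2 * mu < \tr M.
Proof.
have : (Tmx R *m u) 0 0 = - u 1 0 /\ (Tmx R *m u) 1 0 = u 0 0.
  by rewrite !mulmx_ord2E !mx2E; split; ring.
move: (Tmx R *m u) => v [v0 v1] [_ b0 c0 _] [u0 u1] /matrixP eigen.
have := eigen 0 0; have := eigen 1 0.
rewrite !mulmx_ord2E mxtrace_mx22 !mxE v0 v1 => e1 e0.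
have lt0 : mu < M 0 0 by rewrite -(ltr_pM2r u1); have := mulr_gt0 b0 u0; lra.
have lt1 : mu < M 1 1 by rewrite -(ltr_pM2r u0); have := mulr_gt0 c0 u1; lra.
lra.
Qed.

End Mx2.

(** * Words *)

Lemma cat_comm_power (A : eqType) (x y : seq A) : x ++ y = y ++ x ->
  exists (u : seq A) (a b : nat), x = flatten (nseq a u) /\ y = flatten (nseq b u).
Proof.
have [n] := ubnP (size x + size y); elim: n x y => // n IH x y sz comm.
wlog le_xy : x y sz comm / (size x <= size y)%N => [hwlog|].
  have [/hwlog|/ltnW/hwlog] := leqP (size x) (size y); first exact.
  rewrite addnC => /(_ sz (esym comm)) [u [a [b [-> ->]]]].
  by exists u, b, a.
have [->|x0] := eqVneq x [::]; first by exists y, 0%N, 1%N; rewrite /= cats0.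
have sx : (0 < size x)%N by rewrite lt0n size_eq0.
have /prefixP[y' yE] : prefix x y.
  by rewrite prefixE -(takel_cat x le_xy) -comm take_size_cat.
have comm' : x ++ y' = y' ++ x.
  by move: comm; rewrite yE -catA => /eqP; rewrite eqseq_cat // eqxx => /eqP.
have [||u [a [b [xu yu]]]] := IH x y' => //.
  by move: sz; rewrite yE size_cat; lia.
by exists u, a, (a + b)%N; rewrite nseqD flatten_cat -xu -yu.
Qed.

Lemma cat_conj_rot (A : eqType) (x y z : seq A) : (0 < size y)%N ->
  x ++ z = z ++ y -> exists2 i, (i < size y)%N & x = rot i y.
Proof.
move=> y0; have [n] := ubnP (size z); elim: n z => // n IH z sz conj.
have sxy : size x = size y by have := congr1 size conj; rewrite !size_cat; lia.
have [lt_zx|le_xz] := ltnP (size z) (size x).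
  have /prefixP[x' xE] : prefix z x.
    by rewrite prefixE -(takel_cat z (ltnW lt_zx)) conj take_size_cat.
  have yE : y = x' ++ z.
    by move: conj; rewrite xE -catA => /eqP; rewrite eqseq_cat // eqxx => /eqP.
  have [z0|z0] := eqVneq z [::].
    by exists 0%N; rewrite // rot0 xE yE z0 cats0.
  exists (size x'); last by rewrite yE rot_size_cat.
  by rewrite yE size_cat -[ltnLHS]addn0 ltn_add2l lt0n size_eq0.
have /prefixP[z' zE] : prefix x z.
  by rewrite prefixE -(takel_cat y le_xz) -conj take_size_cat.
apply: (IH z'); first by move: sz; rewrite zE size_cat; lia.
by move: conj; rewrite {1 2}zE -!catA => /eqP; rewrite eqseq_cat // eqxx => /eqP.
Qed.

(** * The generators V_j *)

Section Hecke.
Variables (R : realType) (p : nat).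
Hypothesis p_gt2 : (2 < p)%N.
Local Notation theta := (pi / p%:R : R).
Local Notation lambda := (lam R p).
Local Notation S := (Smx R p).
Local Notation T := (Tmx R).
Local Notation U := (Umx R p).
Local Notation V := (Vmx R p).
Local Notation Gamma := (@Gamma R p).
Local Notation gen_prod := (gen_prod R p).
Implicit Types (M N A B : 'M[R]_2) (x y z : R) (v w : seq nat).

Definition sin_ratio (n : nat) : R := sin (n%:R * theta) / sin theta.

Lemma p_mul_theta : p%:R * theta = pi.
Proof. by rewrite mulrC divfK // pnatr_eq0; lia. Qed.

Lemma sin_mul_theta_gt0 n : (0 < n < p)%N -> 0 < sin (n%:R * theta).
Proof.
move=> /andP[n0 np]; have theta0 : 0 < theta by rewrite divr_gt0 ?pi_gt0 // ltr0n; lia.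
apply: sin_gt0_pi; rewrite mulr_gt0 ?ltr0n //=.
by rewrite -[ltRHS]p_mul_theta ltr_pM2r // ltr_nat.
Qed.

Lemma sin_theta_gt0 : 0 < sin theta.
Proof. by have := @sin_mul_theta_gt0 1; rewrite mul1r; apply; lia. Qed.

Lemma sin_theta_neq0 : sin theta != 0.
Proof. by rewrite gt_eqF // sin_theta_gt0. Qed.

Lemma sin_ratio0 : sin_ratio 0 = 0.
Proof. by rewrite /sin_ratio mul0r sin0 mul0r. Qed.

Lemma sin_ratio1 : sin_ratio 1 = 1.
Proof. by rewrite /sin_ratio mul1r divff // sin_theta_neq0. Qed.

Lemma sin_ratio_neighbors n :
  sin_ratio n.+2 = sin_ratio n.+1 * cos theta + cos (n.+1%:R * theta) /\
  sin_ratio n = sin_ratio n.+1 * cos theta - cos (n.+1%:R * theta).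
Proof.
have s0 := sin_theta_neq0; rewrite /sin_ratio; set t := n.+1%:R * theta.
have -> : n.+2%:R * theta = t + theta by rewrite /t -natr1; ring.
have -> : n%:R * theta = t - theta by rewrite /t -natr1; ring.
by rewrite sinD sinB; split; field.
Qed.

Lemma sin_ratioS n : sin_ratio n.+2 = lambda * sin_ratio n.+1 - sin_ratio n.
Proof. by have [-> ->] := sin_ratio_neighbors n; rewrite /lam; ring. Qed.

Lemma sin_ratio2 : sin_ratio 2 = lambda.
Proof. by rewrite sin_ratioS sin_ratio1 sin_ratio0; ring. Qed.

Lemma sin_ratio_p : sin_ratio p = 0.
Proof. by rewrite /sin_ratio p_mul_theta sinpi mul0r. Qed.

Lemma sin_ratio_pS : sin_ratio p.+1 = -1.
Proof.
rewrite /sin_ratio -natr1 mulrDl mul1r p_mul_theta addrC sinDpi mulNr.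
by rewrite divff // sin_theta_neq0.
Qed.

Lemma sin_ratio_gt0 n : (0 < n < p)%N -> 0 < sin_ratio n.
Proof. by move=> np; rewrite divr_gt0 ?sin_mul_theta_gt0 ?sin_theta_gt0. Qed.

Lemma sin_ratio_ge0 n : (n <= p)%N -> 0 <= sin_ratio n.
Proof.
move=> le_np; have [->|n0] := eqVneq n 0%N; first by rewrite sin_ratio0.
have [->|np] := eqVneq n p; first by rewrite sin_ratio_p.
by rewrite ltW // sin_ratio_gt0; lia.
Qed.

Lemma det_Smx : \det S = 1. Proof. by rewrite det_mx22 !mx2E; ring. Qed.

Lemma det_Tmx : \det T = 1. Proof. by rewrite det_mx22 !mx2E; ring. Qed.

Lemma det_Umx : \det U = 1. Proof. by rewrite det_mulmx det_Smx det_Tmx mulr1. Qed.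

Lemma SmxX n : S ^+ n = mx2 1 (n%:R * lambda) 0 1.
Proof.
elim: n => [|n IH]; first by rewrite expr0 mul0r mx2_1.
by rewrite exprS IH mx2M -natr1; congr mx2; ring.
Qed.

Lemma TmxT : T * T = -1.
Proof. by rewrite mx2_1 mx2N mx2M; congr mx2; ring. Qed.

Lemma pm_TmxX (e : bool) : pm (T ^+ (~~ e)) (T * T ^+ e).
Proof. by case: e; rewrite ?expr0 ?expr1 ?mulr1 ?TmxT; [right | left]. Qed.

Lemma Tmx_inv : T^-1 = - T.
Proof. by rewrite det1_inv ?det_Tmx // mx2N !mx2E; congr mx2; ring. Qed.

Lemma UmxE : U = mx2 lambda (-1) 1 0.
Proof. by rewrite /Umx mx2M; congr mx2; ring. Qed.

Lemma VmxE j : V j.+1 =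
  mx2 (sin_ratio j.+1) (sin_ratio j.+2) (sin_ratio j) (sin_ratio j.+1).
Proof.
elim: j => [|j IH].
  by rewrite /Vmx expr0 mul1r sin_ratio2 sin_ratio1 sin_ratio0.
have -> : V j.+2 = U * V j.+1 by rewrite /Vmx /= exprS mulrA.
by rewrite IH UmxE mx2M !sin_ratioS; congr mx2; ring.
Qed.

Lemma det_Vmx j : \det (V j) = 1.
Proof. by rewrite det_mulmx det_Smx det1X ?det_Umx // mulr1. Qed.

Lemma Vmx1 : V 1 = S. Proof. by rewrite /Vmx expr0 mul1r. Qed.

Lemma UmxX_Vmx k j : (0 < j)%N -> U ^+ k * V j = V (k + j)%N.
Proof. by case: j => // j _; rewrite /Vmx mulrA -exprD addnS. Qed.

Lemma Umx_Vmx j : (0 < j)%N -> U * V j = V j.+1.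
Proof. by move=> j0; rewrite -{1}[U]expr1 UmxX_Vmx. Qed.

Lemma Vmx_Tmx j : (0 < j)%N -> V j * T = U ^+ j.
Proof. by case: j => // j _; rewrite /Vmx -mulrA exprSr. Qed.

Lemma Vmx_p : V p = T.
Proof.
have pE : p = p.-1.+1 by lia.
have sinp1 : sin_ratio p.-1 = 1.
  by have := sin_ratioS p.-1; rewrite -pE sin_ratio_p sin_ratio_pS; lra.
by rewrite [X in V X]pE VmxE -pE sin_ratio_p sin_ratio_pS sinp1.
Qed.

Lemma UmxXp : U ^+ p = -1.
Proof. by rewrite -Vmx_Tmx ?Vmx_p ?TmxT //; lia. Qed.

Lemma Vmx_addp j : (0 < j)%N -> V (j + p)%N = - V j.
Proof. by move=> j0; rewrite addnC -UmxX_Vmx // UmxXp mulN1r. Qed.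

Lemma Smx_inv : S^-1 = - (T * U ^+ p.-1).
Proof.
apply: (mulrI (det1_unit det_Smx)); rewrite mulrV ?det1_unit ?det_Smx //.
have pE : p.-1.+1 = p by lia.
by rewrite mulrN mulrA -[S * T]/U -exprS pE UmxXp // opprK.
Qed.

Lemma mxtrace_UmxX_le2 k : `|\tr (U ^+ k)| <= 2.
Proof.
suff -> : \tr (U ^+ k) = 2 * cos (k%:R * theta).
  rewrite normrM ger0_norm // -[leRHS]mulr1 ler_pM2l // ler_norml.
  by rewrite cos_geN1 cos_le1.
case: k => [|k]; first by rewrite expr0 mxtrace1 mul0r cos0 mulr1.
rewrite -Vmx_Tmx // VmxE mx2M mxtrace_mx22 !mx2E.
by have [-> ->] := sin_ratio_neighbors k; ring.
Qed.

Lemma sin_ratio_ge1 n : (0 < n < p)%N -> 1 <= sin_ratio n.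
Proof.
case: n => // n np; have := det_Vmx n.+1; rewrite det_mx22 VmxE !mx2E.
have := sin_ratio_gt0 np.
have : 0 <= sin_ratio n.+2 * sin_ratio n by rewrite mulr_ge0 ?sin_ratio_ge0; lia.
by nra.
Qed.

Lemma lam_ge1 : 1 <= lambda.
Proof. by rewrite -sin_ratio2 sin_ratio_ge1 //; lia. Qed.

Lemma lam_gt0 : 0 < lambda.
Proof. by have := lam_ge1; lra. Qed.

Definition letter j := (0 < j < p)%N.

Lemma nonneg_diag_ge1_V j : letter j -> nonneg_diag_ge1 (V j).
Proof.
case: j => // j /andP[_ jp]; rewrite VmxE /nonneg_diag_ge1 !mx2E.
by split; rewrite ?sin_ratio_ge1 ?sin_ratio_ge0 //; lia.
Qed.

(* After cancelling a power of U the smaller letter becomes S and the larger one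
   U V_k; but S u = U a forces u_0 = - a_1. *)
Lemma Vmx_posv_inj i j (u v : 'cV[R]_2) : letter i -> letter j -> posv u -> posv v ->
  V i *m u = V j *m v -> i = j.
Proof.
wlog: i j u v / (i < j)%N => [hwlog|ij].
  by case: (ltngtP i j) => // lt li lj pu pv e; [|symmetry];
    [exact: (hwlog i j u v) | exact: (hwlog j i v u)].
move=> /andP[i0 _] /andP[_ jp] [u0 u1] pv e; exfalso.
have [k jE] : exists k, j = (i.-1 + k.+2)%N.
  by exists (j - i.-1).-2; move: ij i0; clear; lia.
have lk : letter k.+1 by rewrite /letter; move: jp; rewrite jE; clear; lia.
have [_ a1] := nonneg_diag_ge1_posv (nonneg_diag_ge1_V lk) pv.
have uU : U ^+ i.-1 \in unitmx by apply/det1_unit/det1X/det_Umx.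
have : S *m u = U *m (V k.+1 *m v).
  apply: (can_inj (mulKmx uU)).
  transitivity (V j *m v); first by rewrite -e mulmxA.
  by rewrite (mulmxA U) mulmxA !mulmxE Umx_Vmx // UmxX_Vmx // -jE.
rewrite UmxE; move: (V k.+1 *m v) a1 => a a1 /matrixP eSU.
have := eSU 0 0; have := eSU 1 0; rewrite !mulmx_ord2E !mx2E => e1 e0.
have e1' : a 0 0 = u 1 0 by lra.
by rewrite e1' in e0; lra.
Qed.

Definition Vprod w : 'M[R]_2 := \prod_(j <- w) V j.

Lemma Vprod_nil : Vprod [::] = 1. Proof. exact: big_nil. Qed.

Lemma Vprod_cons j w : Vprod (j :: w) = V j * Vprod w.
Proof. exact: big_cons. Qed.

Lemma Vprod_cat v w : Vprod (v ++ w) = Vprod v * Vprod w.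
Proof. exact: big_cat. Qed.

Lemma Vprod1 j : Vprod [:: j] = V j. Proof. exact: big_seq1. Qed.

Lemma Vprod_rcons w j : Vprod (rcons w j) = Vprod w * V j.
Proof. by rewrite -cats1 Vprod_cat Vprod1. Qed.

Lemma Vprod_nseq n j : Vprod (nseq n j) = V j ^+ n.
Proof. by elim: n => [|n IH]; rewrite /= ?Vprod_nil ?expr0 // Vprod_cons IH exprS. Qed.

Lemma Vprod_flatten_nseq n w : Vprod (flatten (nseq n w)) = Vprod w ^+ n.
Proof.
by elim: n => [|n IH]; rewrite /= ?Vprod_nil ?expr0 // Vprod_cat IH exprS.
Qed.

Lemma det_Vprod w : \det (Vprod w) = 1.
Proof.
elim: w => [|j w IH]; first by rewrite Vprod_nil det1.
by rewrite Vprod_cons det_mulmx det_Vmx IH mulr1.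
Qed.

Lemma Vprod_unit w : Vprod w \is a GRing.unit.
Proof. exact/det1_unit/det_Vprod. Qed.

Lemma nonneg_diag_ge1_Vprod w : all letter w -> nonneg_diag_ge1 (Vprod w).
Proof.
elim: w => [_|j w IH] /=; first by rewrite Vprod_nil; apply: nonneg_diag_ge1_1.
by case/andP=> /nonneg_diag_ge1_V nV /IH; rewrite Vprod_cons; apply: nonneg_diag_ge1M.
Qed.

Lemma Vprod_posv w u : all letter w -> posv u -> posv (Vprod w *m u).
Proof. by move/nonneg_diag_ge1_Vprod; apply: nonneg_diag_ge1_posv. Qed.

Lemma Vprod_posmx w : all letter w -> 2 < \tr (Vprod w) -> posmx (Vprod w).
Proof.
by move=> lw trw; apply: nonneg_diag_ge1_posmx (nonneg_diag_ge1_Vprod lw);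
  rewrite ?det_Vprod.
Qed.

Lemma posmx_Vprod_nonnil w : posmx (Vprod w) -> w != [::].
Proof.
by move=> [_ b0 _ _]; apply/eqP=> wE; rewrite wE Vprod_nil mx2_1 mx2E ltxx in b0.
Qed.

Lemma Vprod_posv_prefix v w (a b : 'cV[R]_2) : all letter v -> all letter w ->
  posv a -> posv b -> Vprod v *m a = Vprod w *m b -> prefix v w || prefix w v.
Proof.
elim: v w => [|i v IH] [|j w] //= /andP[li lv] /andP[lj lw] pa pb.
rewrite !Vprod_cons -!mulmxE -(mulmxA (V i)) -(mulmxA (V j)) => e.
have ij := Vmx_posv_inj li lj (Vprod_posv lv pa) (Vprod_posv lw pb) e.
rewrite ij eqxx /=; apply: IH => //; move: e; rewrite ij.
by apply: (can_inj (mulKmx _)); apply/det1_unit/det_Vmx.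
Qed.

Lemma Vprod_inj v w : all letter v -> all letter w -> Vprod v = Vprod w -> v = w.
Proof.
have p1 : posv (cv2 1 1 : 'cV[R]_2) by exact: posv_cv2.
wlog: v w / prefix v w => [hwlog lv lw e|].
  have := Vprod_posv_prefix lv lw p1 p1 (congr1 (mulmx^~ (cv2 1 1)) e).
  by case/orP=> pre; [|symmetry]; apply: hwlog.
move=> /prefixP[[|j s] ->]; first by rewrite cats0.
rewrite all_cat /= => lv /and3P[_ lj ls]; rewrite Vprod_cat -{1}[Vprod v]mulr1.
move=> /(mulrI (Vprod_unit v)) js1; exfalso.
pose i := if j == 1%N then 2%N else 1%N.
have li : letter i by rewrite /i /letter; case: ifP; lia.
suff ij : i = j.
  by move: ij; rewrite /i; have [-> | /eqP] := eqVneq j 1%N; [|move=> + /esym].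
apply: (Vmx_posv_inj li lj p1 (Vprod_posv (w := rcons s i) _ p1)).
  by rewrite all_rcons li.
by rewrite mulmxA mulmxE Vprod_rcons mulrA -Vprod_cons -js1 mul1r.
Qed.

(** * Normal forms in the Hecke group *)

Lemma Gamma_det M : Gamma M -> \det M = 1.
Proof.
elim=> [|||A B _ detA _ detB|A _ detA].
- exact: det1.
- exact: det_Smx.
- exact: det_Tmx.
- by rewrite det_mulmx detA detB mulr1.
- by rewrite detV detA invr1.
Qed.

Lemma Gamma_unit M : Gamma M -> M \is a GRing.unit.
Proof. by move/Gamma_det/det1_unit. Qed.

Lemma Gamma_pm M N : pm M N -> Gamma M -> Gamma N.
Proof.
case=> -> // GM; rewrite -mulN1r -TmxT.
by do 2?apply: GammaM => //; apply: GammaT.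
Qed.

Lemma Gamma_expr M n : Gamma M -> Gamma (M ^+ n).
Proof.
move=> GM; elim: n => [|n IH]; first by rewrite expr0; apply: Gamma1.
by rewrite exprS; apply: GammaM.
Qed.

Lemma Gamma_UmxX n : Gamma (U ^+ n).
Proof. by apply/Gamma_expr/GammaM; [apply: GammaS | apply: GammaT]. Qed.

Lemma Gamma_Vmx j : Gamma (V j).
Proof. by apply: GammaM; [apply: Gamma_UmxX | apply: GammaS]. Qed.

Lemma Gamma_Vprod w : Gamma (Vprod w).
Proof.
elim: w => [|j w IH]; first by rewrite Vprod_nil; apply: Gamma1.
by rewrite Vprod_cons; apply: GammaM => //; apply: Gamma_Vmx.
Qed.

Lemma Gamma_monoid_ind (P : 'M[R]_2 -> Prop) :
  (forall M N, pm M N -> P M -> P N) -> P 1 -> P S -> P T ->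
  (forall M N, P M -> P N -> P (M * N)) -> forall M, Gamma M -> P M.
Proof.
move=> Ppm P1 PS PT PM M GM; suff: P M /\ P M^-1 by case.
elim: GM => {M} [|||A B GA [PA PA'] GB [PB PB']|A GA [PA PA']].
- by rewrite invr1.
- split=> //; rewrite Smx_inv; apply: (Ppm (T * U ^+ p.-1)); first exact: pmN.
  apply: (PM T) => //; elim: p.-1 => [|n IH]; first by rewrite expr0.
  by rewrite exprS; apply: (PM U) => //; apply: (PM S).
- by split=> //; rewrite Tmx_inv; apply: Ppm PT; apply: pmN.
- by rewrite invrM ?Gamma_unit //; split; apply: PM.
- by rewrite invrK.
Qed.

(* Left multiplication by S consumes at most one letter of the word, and a trailing T
   can only appear once the lower bound [n] on its length has dropped to 0. *)
Definition normal_form (n : nat) M := exists (e e' : bool) w,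
  [/\ all letter w, (n <= size w)%N, e' ==> (n == 0%N)
    & pm (T ^+ e * Vprod w * T ^+ e') M].

Lemma normal_form_pm n M N : pm M N -> normal_form n M -> normal_form n N.
Proof.
move=> MN [e [e' [w [lw sw ne' pmw]]]]; exists e, e', w; split=> //.
exact: pm_trans pmw MN.
Qed.

Lemma normal_form_T n M : normal_form n M -> normal_form n (T * M).
Proof.
move=> [e [e' [w [lw sw ne' pmw]]]]; exists (~~ e), e', w; split=> //.
apply: pm_trans (pmM (pm_refl T) pmw); rewrite !mulrA.
by do 2!(apply: pmM; last exact: pm_refl); apply: pm_TmxX.
Qed.

Lemma normal_form_S n M : normal_form n M -> normal_form n.-1 (S * M).
Proof.
move=> [e [e' [w [lw sw ne' pmw]]]].
apply: normal_form_pm (pmM (pm_refl S) pmw) _ => {pmw}.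
have ne'1 : e' ==> (n.-1 == 0%N) by case: (e') ne' => //= /eqP->.
rewrite /normal_form; case: e => /=; last first.
  exists false, e', (1%N :: w); split=> //=; [|lia|].
    by rewrite lw andbT /letter; lia.
  by rewrite expr0 !mul1r Vprod_cons Vmx1 mulrA; left.
rewrite expr1 !mulrA -[S * T]/U; case: w lw sw => [_|j w /= /andP[lj lw]] sw.
  have n0 : n = 0%N by case: (n) sw.
  rewrite n0; exists false, (~~ e'), [:: 1%N]; split=> //.
  - by rewrite /= /letter; lia.
  - exact: implybT.
  - rewrite expr0 mul1r Vprod1 Vprod_nil mulr1 Vmx1 -[U]/(S * T) -mulrA.
    by apply: pmM; [exact: pm_refl | exact: pm_TmxX].
have j0 : (0 < j)%N by case/andP: lj.
rewrite Vprod_cons mulrA Umx_Vmx //; have [jp|jp] := eqVneq j.+1 p.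
  by exists true, e', w; split=> //; [lia | rewrite jp Vmx_p; left].
exists false, e', (j.+1 :: w); split=> //=; [|lia|].
  by rewrite lw andbT /letter; move: lj; rewrite /letter; lia.
by rewrite mul1r Vprod_cons; left.
Qed.

Lemma Gamma_normal_form_mul M : Gamma M ->
  exists k, forall n N, normal_form n N -> normal_form (n - k) (M * N).
Proof.
apply: (Gamma_monoid_ind (P := fun M => exists k, forall n N,
  normal_form n N -> normal_form (n - k) (M * N)))
  => {M} [A B AB [k Ak]||||A B [k Ak] [l Bl]].
- by exists k => n N /Ak; apply/normal_form_pm/(pmM AB)/pm_refl.
- by exists 0%N => n N; rewrite subn0 mul1r.
- by exists 1%N => n N; rewrite subn1; apply: normal_form_S.
- by exists 0%N => n N; rewrite subn0; apply: normal_form_T.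
- by exists (l + k)%N => n N /Bl/Ak; rewrite mulrA subnDA.
Qed.

Lemma Gamma_normal_form M : Gamma M -> exists (e e' : bool) w,
  all letter w /\ pm (T ^+ e * Vprod w * T ^+ e') M.
Proof.
move=> /Gamma_normal_form_mul [k /(_ 0%N 1)]; rewrite mulr1.
case; last by move=> e [e' [w [lw _ _ pmw]]]; exists e, e', w.
exists false, false, [::]; split=> //.
by rewrite !expr0 Vprod_nil !mulr1; apply: pm_refl.
Qed.

Lemma Gamma_absorb M w : Gamma M -> all letter w -> w != [::] ->
  exists (k : nat) (e : bool) v,
    all letter v /\ pm (T ^+ e * Vprod v) (M * Vprod w ^+ k).
Proof.
move=> /Gamma_normal_form_mul [k /(_ k.+1 (Vprod w ^+ k.+1))].
rewrite subSnn => absorb lw w0.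
case: absorb => [|e [e' [v [lv _ e'0 pmv]]]]; last first.
  exists k.+1, e, v; split=> //; move: e'0 pmv; rewrite implybF => /negbTE ->.
  by rewrite expr0 mulr1.
exists false, false, (flatten (nseq k.+1 w)); split=> //.
- by elim: k.+1 => //= n IH; rewrite all_cat lw.
- elim: k.+1 => //= n IH.
  by rewrite size_cat -add1n leq_add // lt0n size_eq0.
- by rewrite expr0 mul1r mulr1 Vprod_flatten_nseq; left.
Qed.

Lemma posmx_Vprod M : Gamma M -> posmx M -> exists2 w, all letter w & M = Vprod w.
Proof.
move=> /Gamma_normal_form [e [e' [w [lw pmw]]]] [].
have [] := nonneg_diag_ge1_Vprod lw; move: pmw; rewrite [Vprod w]mx2_eta !mx2E.
case: e e' => -[]; rewrite ?expr0 ?expr1 ?mul1r ?mulr1 ?mx2M => -[] ->;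
  rewrite ?mx2N !mx2E; try (by move=> *; lra).
by move=> *; exists w; rewrite // -mx2_eta.
Qed.

(** * Conjugacy classes *)

Definition Gamma_conj M N := exists2 A, Gamma A & N = A * M * A^-1.

Lemma Gamma_conj_refl M : Gamma_conj M M.
Proof. by exists 1; [apply: Gamma1 | rewrite mul1r invr1 mulr1]. Qed.

Lemma Gamma_conj_sym M N : Gamma_conj M N -> Gamma_conj N M.
Proof.
case=> A GA ->; exists A^-1; first exact: GammaV.
by rewrite invrK !mulrA mulVr ?mul1r ?divrK ?Gamma_unit.
Qed.

Lemma Gamma_conj_trans M N A : Gamma_conj M N -> Gamma_conj N A -> Gamma_conj M A.
Proof.
move=> [B GB ->] [D GD ->]; exists (D * B); first exact: GammaM.
by rewrite invrM ?Gamma_unit // !mulrA.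
Qed.

Lemma Gamma_conjC M N : Gamma M -> Gamma_conj (M * N) (N * M).
Proof.
move=> GM; apply: Gamma_conj_sym; exists M => //.
by rewrite mulrA mulrK ?Gamma_unit.
Qed.

Lemma Gamma_conj_Gamma M N : Gamma_conj M N -> Gamma M -> Gamma N.
Proof. by case=> A GA -> GM; do 2?apply: GammaM => //; apply: GammaV. Qed.

Lemma Gamma_conj_trace M N : Gamma_conj M N -> \tr N = \tr M.
Proof. by case=> A GA ->; rewrite mxtrace_conj ?Gamma_unit. Qed.

Lemma conj_classP M N : conj_class p M (pm N) <-> exists2 N', Gamma_conj M N' & pm N' N.
Proof.
split=> [[A GA /pmP/pm_sym AMN]|[_ [A GA ->] AMN]].
  by exists (A * M * A^-1) => //; exists A.
by exists A => //; apply/pmP/pm_sym.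
Qed.

Lemma conj_class_conj M N : Gamma_conj M N -> conj_class p M = conj_class p N.
Proof.
have sub A B : Gamma_conj A B -> conj_class p B `<=` conj_class p A.
  move=> AB x [D GD ->]; have [E GE ->] : Gamma_conj A (D * B * D^-1).
    by apply: Gamma_conj_trans AB _; exists D.
  by exists E.
by move=> MN; apply/seteqP; split; apply: sub => //; apply: Gamma_conj_sym.
Qed.

Lemma conj_classN M : conj_class p (- M) = conj_class p M.
Proof.
have sub A : conj_class p (- A) `<=` conj_class p A.
  move=> x [D GD ->]; exists D => //; apply/pmP.
  by rewrite mulrN mulNr; apply/pm_sym/pmN.
by apply/seteqP; split; rewrite // -{1}[M]opprK.
Qed.

Lemma conj_class_pm M N : pm M N -> conj_class p N = conj_class p M.
Proof. by case=> -> //; apply: conj_classN. Qed.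

Lemma conj_class_id M : conj_class p M (pm M).
Proof. by apply/conj_classP; exists M; [apply: Gamma_conj_refl | apply: pm_refl]. Qed.

(* Cyclic reduction: moving V_k T = U^k to the front merges it with the first letter
   V_i into V_(k + i), which is a letter, T, or minus a letter. *)
Lemma conj_class_Vprod_T w : all letter w -> 2 < `|\tr (Vprod w * T)| ->
  exists2 v, all letter v & conj_class p (Vprod w * T) = conj_class p (Vprod v).
Proof.
have [n] := ubnP (size w); elim: n w => // n IH w.
case/lastP: w => [|w k] sz.
  by rewrite Vprod_nil mul1r mxtrace_mx22 !mx2E addr0 normr0 ltNge ler0n.
rewrite all_rcons => /andP[lk lw]; have k0 : (0 < k)%N by case/andP: lk.
rewrite Vprod_rcons -mulrA Vmx_Tmx //.
have conjU := Gamma_conj_sym (Gamma_conjC (Vprod w) (Gamma_UmxX k)).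
rewrite (conj_class_conj conjU) -(Gamma_conj_trace conjU).
case: w lw sz {conjU} => [_ _|i w /= /andP[li lw] sz].
  by rewrite Vprod_nil mulr1 ltNge mxtrace_UmxX_le2.
have i0 : (0 < i)%N by case/andP: li.
rewrite Vprod_cons mulrA UmxX_Vmx //; have [ki|ki|ki] := ltngtP (k + i)%N p.
- move=> _; exists ((k + i)%N :: w); last by rewrite Vprod_cons.
  by rewrite /= lw andbT /letter ki; lia.
- move=> _; exists ((k + i - p)%N :: w).
    by rewrite /= lw andbT /letter; move: li lk; rewrite /letter; lia.
  rewrite -{1}(subnK (ltnW ki)) Vmx_addp ?subn_gt0 //.
  by rewrite mulNr conj_classN Vprod_cons.
- have conjT := Gamma_conjC (Vprod w) (GammaT R p).
  rewrite ki Vmx_p (conj_class_conj conjT) -(Gamma_conj_trace conjT).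
  by apply: IH => //; move: sz; rewrite size_rcons; lia.
Qed.

Lemma hyperbolic_conj_class M : hyperbolic p M ->
  exists2 w, all letter w & conj_class p M = conj_class p (Vprod w).
Proof.
move=> [GM]; have [e [e' [w [lw pmM]]]] := Gamma_normal_form GM.
rewrite -(conj_class_pm (pm_sym pmM)) (pm_norm_trace pmM).
have GTX k : Gamma (T ^+ k) by apply/Gamma_expr/GammaT.
have conjT := Gamma_conjC (Vprod w * T ^+ e') (GTX e).
rewrite mulrA -(mulrA _ _ (T ^+ e)) -exprD in conjT.
rewrite (conj_class_conj conjT) -(Gamma_conj_trace conjT).
case: e e' {pmM conjT} => -[]; rewrite /= ?expr0 ?expr1 ?mulr1; first last.
- by exists w.
- exact: conj_class_Vprod_T.
- exact: conj_class_Vprod_T.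
- by rewrite exprS expr1 TmxT mulrN1 conj_classN; exists w.
Qed.

Lemma hyperbolic_conj_posmx M : hyperbolic p M -> 0 < \tr M ->
  exists2 N, Gamma_conj M N & posmx N.
Proof.
move=> hypM trM; have [w lw MwE] := hyperbolic_conj_class hypM; have [_ tr2] := hypM.
rewrite gtr0_norm // in tr2.
have [N MN Nw] : exists2 N, Gamma_conj M N & pm N (Vprod w).
  by apply/conj_classP; rewrite MwE; apply: conj_class_id.
have trN := Gamma_conj_trace MN.
have [a1 _ _ d1] := nonneg_diag_ge1_Vprod lw.
exists N => //; case: Nw => wE; last first.
  exfalso; have : \tr (Vprod w) = - \tr M by rewrite wE raddfN /= trN.
  by rewrite mxtrace_mx22; lra.
by rewrite -wE; apply: Vprod_posmx; rewrite ?wE ?trN.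
Qed.

Lemma prim_hyp_pm M N : pm M N -> prim_hyp p M -> prim_hyp p N.
Proof.
move=> MN [[GM trM] primM]; split.
  by split; [exact: Gamma_pm GM | rewrite (pm_norm_trace MN)].
move=> [B [k [GB k2 powB]]]; apply: primM; exists B, k; split=> //.
by rewrite -powB; apply/pmP.
Qed.

Lemma prim_hyp_conj M N : Gamma_conj M N -> prim_hyp p M -> prim_hyp p N.
Proof.
move=> MN [[GM trM] primM]; split.
  by split; [exact: Gamma_conj_Gamma GM | rewrite (Gamma_conj_trace MN)].
move=> [B [k [GB k2 /pmP powB]]]; apply: primM.
have [A GA ->] := Gamma_conj_sym MN; have uA := Gamma_unit GA.
have conjX : A * B ^+ k * A^-1 = (A * B * A^-1) ^+ k.
  elim: k {k2 powB} => [|k IH]; first by rewrite !expr0 mulr1 mulrV.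
  by rewrite exprS [RHS]exprS -IH !mulrA divrK.
exists (A * B * A^-1), k; split=> //.
  by apply: GammaM; [apply: GammaM | apply: GammaV].
by apply/pmP; rewrite -conjX; apply: pmM (pmM (pm_refl A) powB) (pm_refl _).
Qed.

Lemma prim_hyp_Gamma M : prim_hyp p M -> Gamma M.
Proof. by case=> -[]. Qed.

Lemma prim_hyp_det M : prim_hyp p M -> \det M = 1.
Proof. by move/prim_hyp_Gamma/Gamma_det. Qed.

Lemma prim_hyp_trace_gt2 M : prim_hyp p M -> 0 < \tr M -> 2 < \tr M.
Proof. by move=> [[_ tr2] _] tr0; rewrite gtr0_norm in tr2. Qed.

Lemma prim_hyp_conj_class M N : prim_hyp p M -> conj_class p M (pm N) -> prim_hyp p N.
Proof.
by move=> pM /conj_classP[A MA AN]; apply: prim_hyp_pm AN (prim_hyp_conj MA pM).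
Qed.

Lemma conj_class_pos_trace M N : 0 < \tr M -> 0 < \tr N ->
  conj_class p M (pm N) <-> Gamma_conj M N.
Proof.
move=> trM trN; rewrite conj_classP; split=> [[N' MN']|MN]; last first.
  by exists N; last exact: pm_refl.
case=> NE; first by rewrite NE.
by move: trN; rewrite NE raddfN /= (Gamma_conj_trace MN') oppr_gt0 ltNge ltW.
Qed.

Lemma prim_hyp_class_rep (C : set (set 'M[R]_2)) : prim_hyp_class p C ->
  exists M, [/\ prim_hyp p M, 0 < \tr M & C = conj_class p M].
Proof.
move=> [M pM ->]; have [[_ trM] _] := pM.
have [tr0|tr0] := ltP 0 (\tr M); first by exists M.
exists (- M); split; [|by rewrite raddfN /=; rewrite ler0_norm in trM; lra|].
  by apply: prim_hyp_pm pM; apply: pmN.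
by rewrite conj_classN.
Qed.

Lemma Gamma_conj_Vprod_rot w i : Gamma_conj (Vprod w) (Vprod (rot i w)).
Proof.
rewrite -{1}[w](cat_take_drop i) /rot !Vprod_cat.
exact/Gamma_conjC/Gamma_Vprod.
Qed.

Lemma posmx_Vprod_rot w i : all letter w -> 2 < \tr (Vprod w) ->
  posmx (Vprod (rot i w)).
Proof.
move=> lw trw; apply: Vprod_posmx; first by rewrite (eq_all_r (mem_rot i w)).
by rewrite (Gamma_conj_trace (Gamma_conj_Vprod_rot w i)).
Qed.

(* By [Gamma_absorb], [A W^k] is [T^e B] up to sign for a word [B], so that
   [T^e B W = N T^e B].  The case [e = 1] is excluded by comparing the eigenvalues of
   [W] and [N], since T turns the eigenvector of [W] into one of [N] with coordinates
   of opposite signs. *)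
Lemma posmx_conj_Vprod_rot w N : all letter w -> 2 < \tr (Vprod w) ->
  Gamma_conj (Vprod w) N -> posmx N -> exists2 i, (i < size w)%N & N = Vprod (rot i w).
Proof.
move=> lw trw conjN posN; have posW := Vprod_posmx lw trw.
have GN := Gamma_conj_Gamma conjN (Gamma_Vprod w).
have trN := Gamma_conj_trace conjN.
have w0 := posmx_Vprod_nonnil posW.
have [A GA NE] := conjN; have [k [e [b [lb pmb]]]] := Gamma_absorb GA lw w0.
have comm : T ^+ e * Vprod b * Vprod w = N * (T ^+ e * Vprod b).
  have commA : A * Vprod w ^+ k * Vprod w = N * (A * Vprod w ^+ k).
    by rewrite NE !mulrA divrK ?Gamma_unit // -!mulrA -exprSr exprS.
  case: pmb => AWk; rewrite AWk in commA; first exact: commA.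
  by rewrite mulrN mulNr in commA; apply: oppr_inj.
case: e {pmb} comm => comm; rewrite /= ?expr1 ?expr0 ?mul1r in comm.
  exfalso; set z := alpha_mx (Vprod w).
  have fz : fixes (Vprod w) z by apply: alpha_fixes; rewrite ?det_Vprod ?posmx_neq0.
  have pz : posv (cv2 z 1) by apply/posv_cv2/alpha_gt0; rewrite ?det_Vprod.
  have eigenW := fixes_eigen fz.
  have eigenN : N *m (T *m (Vprod b *m cv2 z 1)) =
      (Vprod w 1 0 * z + Vprod w 1 1) *: (T *m (Vprod b *m cv2 z 1)).
    rewrite (mulmxA T) mulmxA !mulmxE -comm -mulmxE -mulmxA eigenW.
    by rewrite -scalemxAr.
  have := posmx_eigen_posv posW pz eigenW.
  have := posmx_eigen_Tposv posN (Vprod_posv lb pz) eigenN.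
  by rewrite trN; lra.
have [n ln nE] := posmx_Vprod GN posN; rewrite nE -!Vprod_cat in comm.
have : n ++ b = b ++ w by apply: Vprod_inj; rewrite ?all_cat ?ln ?lb.
case/cat_conj_rot => [|i iw nrot]; first by rewrite lt0n size_eq0.
by exists i; rewrite // nE nrot.
Qed.

(** * Equivalence classes of forms *)

Lemma bqf_act_Qmx M A : \det A = 1 -> bqf_act (Qmx M) A = Qmx (A^-1 * M * A).
Proof.
move=> detA; rewrite det1_inv // /bqf_act /Qmx /=.
by congr Bqf; rewrite !mulmx_ord2E !mx2E; ring.
Qed.

Lemma Qmx_inj M N : \det M = 1 -> \det N = 1 -> 0 < \tr M -> 0 < \tr N ->
  Qmx M = Qmx N -> M = N.
Proof.
rewrite !det_mx22 !mxtrace_mx22 => detM detN trM trN [e10 ed e01].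
have {}e01 : M 0 1 = N 0 1 by apply: oppr_inj.
have tr2E : (M 0 0 + M 1 1) ^+ 2 = (N 0 0 + N 1 1) ^+ 2.
  transitivity ((M 1 1 - M 0 0) ^+ 2 + 4 * (M 0 0 * M 1 1)); first by ring.
  have -> : M 0 0 * M 1 1 = N 0 0 * N 1 1 by rewrite e10 e01 in detM; lra.
  by rewrite ed; ring.
have trE : M 0 0 + M 1 1 = N 0 0 + N 1 1.
  by move/eqP: tr2E; rewrite eqrXn2 ?ltW // => /eqP.
by apply: matrix22P => //; lra.
Qed.

Lemma Qmx_neq_Qmx0 N : \det N = 1 -> 2 < \tr N -> Qmx N <> Qmx 0.
Proof.
rewrite det_mx22 mxtrace_mx22 /Qmx !mxE => detN trN [c0 ad _].
by have dE : N 1 1 = N 0 0; [lra | rewrite c0 dE in detN trN; nra].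
Qed.

Lemma in_ZlamD x y : in_Zlam p x -> in_Zlam p y -> in_Zlam p (x + y).
Proof. by move=> [a ->] [b ->]; exists (a + b); rewrite rmorphD hornerD. Qed.

Lemma in_ZlamM x y : in_Zlam p x -> in_Zlam p y -> in_Zlam p (x * y).
Proof. by move=> [a ->] [b ->]; exists (a * b); rewrite rmorphM hornerM. Qed.

Lemma in_ZlamN x : in_Zlam p x -> in_Zlam p (- x).
Proof. by move=> [a ->]; exists (- a); rewrite rmorphN hornerN. Qed.

Lemma in_Zlam0 : in_Zlam p (0 : R).
Proof. by exists 0; rewrite rmorph0 horner0. Qed.

Lemma in_Zlam1 : in_Zlam p (1 : R).
Proof. by exists 1; rewrite rmorph1 hornerC. Qed.

Lemma in_Zlam_lam : in_Zlam p lambda.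
Proof. by exists 'X; rewrite map_polyX hornerX. Qed.

Lemma Gamma_in_Zlam M : Gamma M ->
  [/\ in_Zlam p (M 0 0), in_Zlam p (M 0 1), in_Zlam p (M 1 0) & in_Zlam p (M 1 1)].
Proof.
have Z0 := in_Zlam0; have Z1 := in_Zlam1; have Zlam := in_Zlam_lam.
have ZN1 := in_ZlamN Z1.
elim=> [|||A B _ [a b c d] _ [a' b' c' d']|A GA [a b c d]].
- by rewrite mx2_1 !mx2E.
- by rewrite !mx2E.
- by rewrite !mx2E.
- by rewrite !mulmx_ord2E; split; apply: in_ZlamD; apply: in_ZlamM.
- by rewrite det1_inv ?Gamma_det // !mx2E; split=> //; apply: in_ZlamN.
Qed.

Lemma lambda_bqf_Qmx M : Gamma M -> lambda_bqf p (Qmx M).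
Proof.
move/Gamma_in_Zlam=> [a b c d]; split=> //=; last exact: in_ZlamN.
by apply: in_ZlamD => //; apply: in_ZlamN.
Qed.

Lemma bqf_class_QmxP M Q : Gamma M ->
  bqf_class p (Qmx M) Q <-> exists2 N, Gamma_conj M N & Q = Qmx N.
Proof.
move=> GM; split=> [[_ [A GA ->]]|[N MN ->]].
  exists (A^-1 * M * A); last by rewrite bqf_act_Qmx ?Gamma_det.
  by exists A^-1; [apply: GammaV | rewrite invrK].
split; first exact/lambda_bqf_Qmx/(Gamma_conj_Gamma MN).
have [A GA ->] := MN; exists A^-1; first exact: GammaV.
by rewrite bqf_act_Qmx ?invrK // detV Gamma_det ?invr1.
Qed.

Lemma bqf_class_Qmx_conj M N : Gamma M -> Gamma_conj M N ->
  bqf_class p (Qmx M) = bqf_class p (Qmx N).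
Proof.
move=> GM MN; have GN := Gamma_conj_Gamma MN GM.
apply/seteqP; split=> Q /bqf_class_QmxP [//|A conjA ->]; apply/bqf_class_QmxP => //;
  exists A => //; apply: Gamma_conj_trans conjA => //; exact: Gamma_conj_sym.
Qed.

Lemma hyperbolic_bqf_class_Qmx M : prim_hyp p M -> 0 < \tr M ->
  hyperbolic_bqf_class p (bqf_class p (Qmx M)).
Proof.
move=> pM trM; exists (Qmx M) => //; split; last by exists M.
exact/lambda_bqf_Qmx/prim_hyp_Gamma.
Qed.

Lemma forms_of_conj_class M N : prim_hyp p M -> 0 < \tr M -> 0 < \tr N ->
  conj_class p M (pm N) -> forms_of p (conj_class p M) = bqf_class p (Qmx N).
Proof.
move=> pM trM trN MN; have GM := prim_hyp_Gamma pM.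
have toM A : conj_class p M (pm A) -> 0 < \tr A ->
    bqf_class p (Qmx A) = bqf_class p (Qmx M).
  by move=> MA trA; symmetry; apply/bqf_class_Qmx_conj/conj_class_pos_trace.
apply/seteqP; split=> Q; last by move=> NQ; exists N.
by move=> [A [MA trA]]; rewrite (toM A) // -(toM N).
Qed.

Lemma forms_of_prim_hyp M : prim_hyp p M -> 0 < \tr M ->
  forms_of p (conj_class p M) = bqf_class p (Qmx M).
Proof. by move=> pM trM; apply: forms_of_conj_class => //; apply: conj_class_id. Qed.

(** * Simple numbers *)

Lemma Vprod_fixes_comm v w z : all letter v -> all letter w -> 0 < z ->
  fixes (Vprod v) z -> fixes (Vprod w) z -> v ++ w = w ++ v.
Proof.
move=> lv lw z0 fv fw; have pz := posv_cv2 z0.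
have lvw : all letter (v ++ w) by rewrite all_cat lv.
have lwv : all letter (w ++ v) by rewrite all_cat lw.
have : Vprod (v ++ w) *m cv2 z 1 = Vprod (w ++ v) *m cv2 z 1.
  rewrite !Vprod_cat -!mulmxE -!mulmxA (fixes_eigen fv) (fixes_eigen fw).
  by rewrite -!scalemxAr (fixes_eigen fv) (fixes_eigen fw) !scalerA mulrC.
have sz : size (v ++ w) = size (w ++ v) by rewrite !size_cat addnC.
case/(Vprod_posv_prefix lvw lwv pz pz)/orP; rewrite prefixE.
  by rewrite sz take_size => /eqP.
by rewrite -sz take_size => /eqP.
Qed.

(* By [Gamma_absorb], [N W^k] is a word up to sign, so it commutes with [W]. *)
Lemma Gamma_fixes_comm N w z : Gamma N -> all letter w -> 0 < z ->
  fixes N z -> fixes (Vprod w) z -> N * Vprod w = Vprod w * N.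
Proof.
move=> GN lw z0 fN fw.
have [->|w0] := eqVneq w [::]; first by rewrite Vprod_nil mulr1 mul1r.
have [k [e [v [lv pmv]]]] := Gamma_absorb GN lw w0.
have := fixes_pm (pm_sym pmv) (fixesM fN (fixesX k fw)).
case: e pmv => pmv; rewrite /= ?expr1 ?expr0 ?mul1r in pmv *.
  by move/(nonneg_Tmx_not_fixes (nonneg_diag_ge1_Vprod lv) z0).
move=> fv; have vw : Vprod v * Vprod w = Vprod w * Vprod v.
  by rewrite -!Vprod_cat (Vprod_fixes_comm lv lw z0 fv fw).
have comm : N * Vprod w ^+ k * Vprod w = Vprod w * (N * Vprod w ^+ k).
  by case: pmv => ->; rewrite ?mulNr ?mulrN vw.
have uWk : Vprod w ^+ k \is a GRing.unit by apply/unitrX/Vprod_unit.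
by apply: (mulIr uWk); rewrite -!mulrA -exprS exprSr !mulrA in comm *.
Qed.

Lemma posmx_fixes_share M N z z' : Gamma M -> Gamma N -> posmx N -> 0 < z ->
  fixes N z -> fixes N z' -> fixes M z -> fixes M z'.
Proof.
move=> GM GN pN z0 fz fz' fM; have [w lw NE] := posmx_Vprod GN pN.
have NM : N * M = M * N.
  by rewrite NE (Gamma_fixes_comm GM lw z0 fM) // -NE.
by apply: comm_fixes NM _ fz'; rewrite ?Gamma_det ?oner_eq0 ?posmx_neq0.
Qed.

Lemma prim_Vprod_comm v w : v != [::] -> w != [::] -> v ++ w = w ++ v ->
  ~ is_power p (Vprod v) -> ~ is_power p (Vprod w) -> v = w.
Proof.
move=> v0 w0 /cat_comm_power [u [a [b [vE wE]]]] primv primw.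
have exponent1 s k : s != [::] -> s = flatten (nseq k u) ->
    ~ is_power p (Vprod s) -> k = 1%N.
  case: k => [|[|k]] // s0 sE []; first by rewrite sE in s0.
  exists (Vprod u), k.+2; split=> //; first exact: Gamma_Vprod.
  by rewrite sE Vprod_flatten_nseq.
by rewrite vE wE (exponent1 _ _ v0 vE primv) (exponent1 _ _ w0 wE primw).
Qed.

Lemma prim_posmx_fixes_eq M N z : prim_hyp p M -> prim_hyp p N -> posmx M -> posmx N ->
  0 < z -> fixes M z -> fixes N z -> M = N.
Proof.
move=> pM pN posM posN z0 fM fN.
have [v lv ME] := posmx_Vprod (prim_hyp_Gamma pM) posM.
have [w lw NE] := posmx_Vprod (prim_hyp_Gamma pN) posN.
rewrite ME NE in pM pN posM posN fM fN *; congr Vprod; apply: prim_Vprod_comm.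
- exact: posmx_Vprod_nonnil.
- exact: posmx_Vprod_nonnil.
- exact: Vprod_fixes_comm fM fN.
- by case: pM.
- by case: pN.
Qed.

Lemma simple_num_posmx z : simple_num p z -> exists N z',
  [/\ Gamma N, posmx N, z' < 0 < z, fixes N z & fixes N z'].
Proof.
move=> [_]; rewrite /hecke_conj; case: xgetP => [z' _|_]; last by rewrite ltxx.
move=> [_ [M [[GM trM] fz fz']]] opp.
wlog {trM} trM : M GM fz fz' / 2 < \tr M => [hwlog|].
  have [tr0|tr0] := ltP 0 (\tr M).
    by apply: (hwlog M); rewrite // gtr0_norm in trM *.
  apply: (hwlog (- M)); first exact: Gamma_pm (pmN M) GM.
  - exact: fixes_pm (pmN M) fz.
  - exact: fixes_pm (pmN M) fz'.
  - by rewrite raddfN /=; rewrite ler0_norm in trM.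
have [posM|posM] := opposite_fixes_posmxV (Gamma_det GM) trM opp fz fz'.
  by exists M, z'.
have uM := Gamma_unit GM.
by exists M^-1, z'; split=> //; [exact: GammaV | exact: fixesV | exact: fixesV].
Qed.

Lemma hecke_conj_posmx N z z' : hyperbolic p N -> posmx N -> z' < 0 < z ->
  fixes N z -> fixes N z' -> hecke_conj p z = z'.
Proof.
move=> hypN posN opp fz fz'; have [GN _] := hypN.
have zz' := opposite_neq opp; have /andP[_ z0] := opp.
rewrite /hecke_conj; case: xgetP => [y _ [yz [M [[GM trM] Mz My]]]|]; last first.
  by move=> /(_ z') []; split=> //; exists N.
have Mz' := posmx_fixes_share GM GN posN z0 fz fz' Mz.
have c0 := distinct_fixes_neq0 (Gamma_det GM) trM Mz Mz' zz'.
have [sum _] := fixes_vieta Mz Mz' zz'; have [sumy _] := fixes_vieta Mz My yz.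
by apply: (mulfI c0); lra.
Qed.

Lemma hyperbolic_posmx_trace N : hyperbolic p N -> posmx N -> 2 < \tr N.
Proof. by move=> [_ trN] /posmx_trace_gt0 tr0; rewrite gtr0_norm in trN. Qed.

Lemma simple_num_alpha N : hyperbolic p N -> posmx N -> simple_num p (alpha_mx N).
Proof.
move=> hypN posN; have trN := hyperbolic_posmx_trace hypN posN.
have detN := Gamma_det hypN.1.
have fal := alpha_fixes detN trN (posmx_neq0 posN).
have al0 := alpha_gt0 detN trN posN.
have [z' z'0 fz'] := posmx_fixes_lt0 detN trN posN.
split; first by exists N.
by rewrite (hecke_conj_posmx (z' := z') hypN posN) ?z'0.
Qed.

Lemma simple_num_attracting N z : simple_num p z -> Gamma N -> 2 < \tr N ->
  attracting N z -> posmx N /\ z = alpha_mx N.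
Proof.
move=> sz GN trN atN; have detN := Gamma_det GN; have [fN _] := atN.
have [M [z' [GM posM opp fz fz']]] := simple_num_posmx sz.
have /andP[_ z0] := opp.
have fN' := posmx_fixes_share GN GM posM z0 fz fz' fN.
have c0 : N 1 0 != 0.
  apply: distinct_fixes_neq0 fN fN' (opposite_neq opp) => //.
  by rewrite gtr0_norm //; lra.
have zE : z = alpha_mx N by apply/attracting_alphaP.
by split=> //; apply: alpha_opposite_posmx fN' _; rewrite // -zE.
Qed.

Lemma prim_mx_alpha N : prim_hyp p N -> posmx N -> prim_mx p (alpha_mx N) = N.
Proof.
move=> pN posN; have [hypN _] := pN; have trN := hyperbolic_posmx_trace hypN posN.
have detN := Gamma_det hypN.1; have c0 := posmx_neq0 posN.
rewrite /prim_mx; case: xgetP => [M _ [pM trM atM]|]; last first.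
  by move=> /(_ N) []; split=> //; [exact: posmx_trace_gt0 | exact/attracting_alphaP].
have [posM _] := simple_num_attracting (simple_num_alpha hypN posN)
  (prim_hyp_Gamma pM) (prim_hyp_trace_gt2 pM trM) atM.
apply: (@prim_posmx_fixes_eq _ _ (alpha_mx N)) => //.
- exact: alpha_gt0.
- by case: atM.
- exact: alpha_fixes.
Qed.

Lemma Zset_QmxP M z : prim_hyp p M -> 0 < \tr M ->
  Zset p (bqf_class p (Qmx M)) z <->
  exists N, [/\ Gamma_conj M N, posmx N & z = alpha_mx N].
Proof.
move=> pM trM; have GM := prim_hyp_Gamma pM.
split=> [[sz /(bqf_class_QmxP _ GM)[N MN]]|[N [MN posN ->]]]; last first.
  have pN := prim_hyp_conj MN pM; have [hypN _] := pN.
  split; first exact: simple_num_alpha.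
  by apply/bqf_class_QmxP => //; exists N; rewrite // /Qnum prim_mx_alpha.
have pN := prim_hyp_conj MN pM; have detN := prim_hyp_det pN.
have trN : 0 < \tr N by rewrite (Gamma_conj_trace MN).
rewrite /Qnum /prim_mx; case: xgetP => [N0 _ [pN0 trN0 atN0] QE|_]; last first.
  by move/esym/(Qmx_neq_Qmx0 detN (prim_hyp_trace_gt2 pN trN)).
have NE : N0 = N by apply: Qmx_inj QE => //; apply: prim_hyp_det.
rewrite NE in atN0; exists N.
have trN2 := prim_hyp_trace_gt2 pN trN.
by have [] := simple_num_attracting sz (prim_hyp_Gamma pN) trN2 atN0.
Qed.

Lemma Zset_Qmx_neq0 M : prim_hyp p M -> 0 < \tr M ->
  Zset p (bqf_class p (Qmx M)) !=set0.
Proof.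
move=> pM trM; have [N MN posN] := hyperbolic_conj_posmx pM.1 trM.
by exists (alpha_mx N); apply/Zset_QmxP => //; exists N.
Qed.

Lemma Zset_Qmx_inj M N : prim_hyp p M -> 0 < \tr M -> prim_hyp p N -> 0 < \tr N ->
  Zset p (bqf_class p (Qmx M)) = Zset p (bqf_class p (Qmx N)) ->
  conj_class p M = conj_class p N.
Proof.
move=> pM trM pN trN ZE; have [z Mz] := Zset_Qmx_neq0 pM trM.
have Nz := Mz; rewrite ZE in Nz.
have [A [MA posA zA]] := (Zset_QmxP z pM trM).1 Mz.
have [B [NB posB zB]] := (Zset_QmxP z pN trN).1 Nz.
rewrite (conj_class_conj MA) (conj_class_conj NB).
rewrite -(prim_mx_alpha (prim_hyp_conj MA pM) posA) -zA zB.
by rewrite (prim_mx_alpha (prim_hyp_conj NB pN) posB).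
Qed.

Lemma Pset_pos (A : set (bqf R)) : [set z | Pset p A z /\ 0 < z] = Zset p A.
Proof.
apply/seteqP; split=> z; last by move=> Az; split; [left | case: Az => -[_ /andP[]]].
move=> [[//|[y [[_ /andP[_ y0]] _] <-]]].
rewrite /mobius !mx2E mul0r add0r mul1r addr0 pmulr_lgt0 ?invr_gt0 //.
by rewrite ltr0N1.
Qed.

Lemma Zset_Vprod w : all letter w -> prim_hyp p (Vprod w) -> 0 < \tr (Vprod w) ->
  Zset p (bqf_class p (Qmx (Vprod w))) =
  [set alpha_mx (Vprod (rot i w)) | i in `I_(size w)].
Proof.
move=> lw pw tr0; have tr2 := prim_hyp_trace_gt2 pw tr0.
apply/seteqP; split=> z.
  move=> /(Zset_QmxP z pw tr0)[N [wN posN ->]].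
  by have [i iw ->] := posmx_conj_Vprod_rot lw tr2 wN posN; exists i.
move=> [i iw <-]; apply/Zset_QmxP => //; exists (Vprod (rot i w)).
by split=> //; [exact: Gamma_conj_Vprod_rot | exact: posmx_Vprod_rot].
Qed.

(** * Continued fractions *)

Lemma mobius_SmxX n x : mobius (S ^+ n) x = x + n%:R * lambda.
Proof. by rewrite SmxX /mobius !mx2E mul0r add0r divr1 mul1r. Qed.

Lemma mobius_SmxVX n x : mobius (S ^- n) x = x - n%:R * lambda.
Proof.
have -> : S ^- n = mx2 1 (- (n%:R * lambda)) 0 1.
  by rewrite det1_inv ?det1X ?det_Smx // SmxX !mx2E oppr0.
by rewrite /mobius !mx2E mul0r add0r invr1; ring.
Qed.

Lemma mobius_V1 x : mobius (V 1) x = x + lambda.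
Proof. by rewrite Vmx1 -[S]expr1 mobius_SmxX mul1r. Qed.

Lemma mobius_V_gt0 k x : (0 < k < p.-1)%N -> 0 <= x -> 0 < mobius (V k) x.
Proof.
case: k => // k /= kp x0; have lk : letter k.+1 by rewrite /letter; lia.
rewrite divr_gt0 ?nonneg_den_gt0 //; last exact: nonneg_diag_ge1_V.
rewrite VmxE !mx2E; apply: ltr_wpDl; last by apply: sin_ratio_gt0; lia.
by rewrite mulr_ge0 ?sin_ratio_ge0 //; lia.
Qed.

Lemma mobius_VS k x : (0 < k < p.-1)%N -> 0 <= x ->
  mobius (V k.+1) x = lambda - (mobius (V k) x)^-1.
Proof.
move=> kp x0; have lk : letter k by rewrite /letter; lia.
rewrite -Umx_Vmx; last by lia.
rewrite nonneg_mobiusM //; last exact: nonneg_diag_ge1_V.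
have := mobius_V_gt0 kp x0; move: (mobius (V k) x) => y y0.
rewrite UmxE /mobius !mx2E; field.
by rewrite gt_eqF //= mul1r addr0 gt_eqF.
Qed.

Lemma lcf_tailD z m n : lcf_tail p z (m + n) = lcf_tail p (lcf_tail p z m) n.
Proof. by elim: n => [|n IH]; rewrite ?addn0 // addnS /= IH. Qed.

Lemma lcf_digitD z m n : lcf_digit p z (m + n) = lcf_digit p (lcf_tail p z m) n.
Proof. by rewrite /lcf_digit lcf_tailD. Qed.

Local Arguments lcf_tail : simpl never.

Lemma lcf_digit0_bounds z r : lcf_digit p z 0 = r ->
  (r - 1)%:~R * lambda <= z < r%:~R * lambda.
Proof.
rewrite /lcf_digit /lcf_tail => rE; have lam0 := lam_gt0.
have -> : r - 1 = Num.floor (z / lambda) by rewrite -rE addrK.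
rewrite -ler_pdivlMr // ge_floor /= -ltr_pdivrMr // -rE.
exact: floorD1_gt.
Qed.

Lemma lcf_digit0_eq z (r : nat) : r%:R * lambda <= z < r.+1%:R * lambda ->
  lcf_digit p z 0 = r.+1%:Z.
Proof.
move=> /andP[lo hi]; rewrite /lcf_digit /lcf_tail; have lam0 := lam_gt0.
have -> : Num.floor (z / lambda) = r%:Z.
  apply: floor_def; rewrite ler_pdivlMr // ltr_pdivrMr //.
  by rewrite -natr1 in hi; rewrite intrD /= -!pmulrn; apply/andP.
by rewrite -addn1 PoszD.
Qed.

Lemma lcf_tail1 z (r : nat) : lcf_digit p z 0 = r%:Z ->
  lcf_tail p z 1 = (r%:R * lambda - z)^-1.
Proof. by rewrite /lcf_digit /lcf_tail => ->. Qed.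

Lemma lcf_digit0_tail1 z (r : nat) : lcf_digit p z 0 = r%:Z ->
  z = r%:R * lambda - (lcf_tail p z 1)^-1.
Proof. by move=> dz; rewrite (lcf_tail1 dz) invrK; ring. Qed.

Fixpoint lcf_starts z (s : seq nat) z' : Prop :=
  if s is r :: s' then lcf_digit p z 0 = r%:Z /\ lcf_starts (lcf_tail p z 1) s' z'
  else z = z'.

Lemma lcf_startsP z s z' : lcf_starts z s z' <-> lcf_tail p z (size s) = z' /\
  forall i, (i < size s)%N -> lcf_digit p z i = (nth 0%N s i)%:Z.
Proof.
elim: s z => [|r s IH] z; first by split=> [->|[]].
rewrite [lcf_starts _ _ _]/= [size _]/= -(add1n (size s)) lcf_tailD; split.
  move=> [dz /IH [tz digits]]; split=> // -[|i] // lti.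
  by rewrite -(add1n i) lcf_digitD digits.
move=> [tz digits]; split; first exact: (digits 0%N).
by apply/IH; split=> // i lti; rewrite -lcf_digitD digits.
Qed.

Lemma lcf_starts_cat z s s' z'' : lcf_starts z (s ++ s') z'' <->
  exists2 z', lcf_starts z s z' & lcf_starts z' s' z''.
Proof.
elim: s z => [|r s IH] z /=.
  by split=> [s'z|[_ <-]] //; exists z.
rewrite IH; split=> [[dz [z' sz s'z]]|[z' [dz sz] s'z]]; first by exists z'.
by split=> //; exists z'.
Qed.

Lemma lcf_starts_self z s : (0 < size s)%N -> lcf_starts z s z ->
  lcf_purely_periodic p z s.
Proof.
move=> s0 /lcf_startsP [tz digits]; split=> // n.
have tzM q : lcf_tail p z (q * size s) = z.
  by elim: q => // q IH; rewrite mulSn lcf_tailD tz.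
by rewrite {1}(divn_eq n (size s)) lcf_digitD tzM digits // ltn_mod.
Qed.

Lemma lcf_purely_periodic_starts z s : lcf_purely_periodic p z s ->
  exists2 z', lcf_starts z s z' & lcf_purely_periodic p z' s.
Proof.
move=> [s0 digits]; exists (lcf_tail p z (size s)).
  by apply/lcf_startsP; split=> // i lti; rewrite digits modn_small.
by split=> // n; rewrite -lcf_digitD digits modnDl.
Qed.

Lemma lcf_mobius_VS n k x : (0 < k < p.-1)%N -> 0 <= x -> 0 < mobius (V k.+1) x ->
  lcf_digit p (n%:R * lambda + mobius (V k.+1) x) 0 = n.+1%:Z /\
  lcf_tail p (n%:R * lambda + mobius (V k.+1) x) 1 = mobius (V k) x.
Proof.
move=> kp x0 VS0; have V0 := mobius_V_gt0 kp x0; have VSE := mobius_VS kp x0.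
have lt_lam : mobius (V k.+1) x < lambda by rewrite VSE ltrBlDr ltrDl invr_gt0.
have dig : lcf_digit p (n%:R * lambda + mobius (V k.+1) x) 0 = n.+1%:Z.
  by apply: lcf_digit0_eq; rewrite -natr1; apply/andP; split; lra.
split=> //; rewrite (lcf_tail1 dig) -natr1 VSE -[RHS]invrK; congr (_^-1); ring.
Qed.

Lemma lcf_starts_ones k x : (k.+1 < p)%N -> 0 < x ->
  lcf_starts (mobius (V k.+1) x) (nseq k 1%N) (x + lambda).
Proof.
move=> + x0; elim: k => [_|k IH kp] /=; first exact: mobius_V1.
have V0 : 0 < mobius (V k.+2) x.
  by apply: nonneg_mobius_gt0 => //; apply: nonneg_diag_ge1_V; rewrite /letter; lia.
have [|dig tail] := @lcf_mobius_VS 0 k.+1 x _ (ltW x0) V0; first by lia.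
rewrite mul0r add0r in dig tail; split=> //; rewrite tail.
by apply: IH; lia.
Qed.

Lemma lcf_starts_ones_inv k x z : (k.+1 < p)%N -> 0 <= x ->
  lcf_starts z (nseq k 1%N) (x + lambda) -> z = mobius (V k.+1) x.
Proof.
move=> + x0; elim: k z => [|k IH] z kp /=; first by rewrite mobius_V1.
move=> [dig /IH tailE]; rewrite (lcf_digit0_tail1 dig) tailE; last by lia.
by rewrite (@mobius_VS k.+1) ?mul1r //; lia.
Qed.

(** * Generator products *)

Definition gen_pair (mj : nat * nat) := (2 <= mj.2 <= p.-1)%N.

Implicit Type ps : seq (nat * nat).

Lemma gen_prod_cons m j ps : gen_prod ((m, j) :: ps) = S ^+ m * V j * gen_prod ps.
Proof. by rewrite /Defs.gen_prod big_cons Vmx1. Qed.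

Definition gen_letters ps : seq nat :=
  flatten [seq rcons (nseq mj.1 1%N) mj.2 | mj <- ps].

Lemma gen_letters_cat ps qs :
  gen_letters (ps ++ qs) = gen_letters ps ++ gen_letters qs.
Proof. by rewrite /gen_letters map_cat flatten_cat. Qed.

Lemma gen_prod_letters ps : gen_prod ps = Vprod (gen_letters ps).
Proof.
rewrite /Defs.gen_prod; elim: ps => [|[m j] ps IH]; first by rewrite big_nil Vprod_nil.
by rewrite big_cons IH Vprod_cat Vprod_rcons Vprod_nseq.
Qed.

Lemma gen_letters_letter ps : all gen_pair ps -> all letter (gen_letters ps).
Proof.
elim: ps => [|[m j] ps IH] //= /andP[gj /IH lps].
rewrite all_cat lps andbT all_rcons all_nseq /letter /=; move: gj; rewrite /gen_pair /=.
by lia.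
Qed.

Definition block_sizes ps : seq nat := [seq mj.1.+1 | mj <- ps].

Lemma size_gen_letters ps : size (gen_letters ps) = sumn (block_sizes ps).
Proof.
rewrite size_flatten /shape -map_comp; congr sumn; apply: eq_map => mj /=.
by rewrite size_rcons size_nseq.
Qed.

Lemma gen_letters_rot t ps :
  rot (size (gen_letters (take t ps))) (gen_letters ps) = gen_letters (rot t ps).
Proof.
by rewrite -{2}(cat_take_drop t ps) gen_letters_cat rot_size_cat -gen_letters_cat.
Qed.

Lemma det_gen_prod ps : \det (gen_prod ps) = 1.
Proof. by rewrite gen_prod_letters det_Vprod. Qed.

Lemma nonneg_gen_prod ps : all gen_pair ps -> nonneg_diag_ge1 (gen_prod ps).
Proof.
by move=> gps; rewrite gen_prod_letters; apply/nonneg_diag_ge1_Vprod/gen_letters_letter.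
Qed.

Lemma gen_prod_trace_gt0 ps : all gen_pair ps -> 0 < \tr (gen_prod ps).
Proof. by move=> /nonneg_gen_prod[a1 _ _ d1]; rewrite mxtrace_mx22; lra. Qed.

Lemma gen_prod_posmx ps : all gen_pair ps -> 2 < \tr (gen_prod ps) ->
  posmx (gen_prod ps).
Proof.
move=> gps trps; apply: nonneg_diag_ge1_posmx trps (nonneg_gen_prod gps).
exact: det_gen_prod.
Qed.

Lemma mxtrace_gen_prod_rot t ps : \tr (gen_prod (rot t ps)) = \tr (gen_prod ps).
Proof.
rewrite !gen_prod_letters -gen_letters_rot.
exact/Gamma_conj_trace/Gamma_conj_Vprod_rot.
Qed.

Lemma cf_period_cons m j ps :
  cf_period ((m, j) :: ps) = (m.+2 :: nseq (j - 2) 1%N) ++ cf_period ps.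
Proof. by []. Qed.

(* S^(m + 2) T U^(j - 2) = S (S^m V_j) S^-1: up to the translation by lambda, a block
   of the period has the effect of the corresponding block of the product. *)
Lemma lcf_starts_block m j x : gen_pair (m, j) -> 0 < x ->
  lcf_starts (mobius (S ^+ m * V j) x + lambda) (m.+2 :: nseq (j - 2) 1%N) (x + lambda).
Proof.
rewrite /gen_pair /= => gj x0; have lj : letter j by rewrite /letter; lia.
have jE : j = (j - 2).+2 by lia.
rewrite nonneg_mobiusM ?(ltW x0) //; last exact: nonneg_diag_ge1_V.
rewrite mobius_SmxX.
have V0 : 0 < mobius (V (j - 2).+2) x.
  by rewrite -jE; apply: nonneg_mobius_gt0 => //; apply: nonneg_diag_ge1_V.
have [|dig tail] := @lcf_mobius_VS m.+1 (j - 2).+1 x _ (ltW x0) V0; first by lia.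
have zE : mobius (V j) x + m%:R * lambda + lambda =
    m.+1%:R * lambda + mobius (V (j - 2).+2) x by rewrite -jE -natr1; ring.
rewrite zE; split=> //; rewrite tail; apply: lcf_starts_ones => //; lia.
Qed.

Lemma lcf_starts_block_inv m j x z : gen_pair (m, j) -> 0 <= x ->
  lcf_starts z (m.+2 :: nseq (j - 2) 1%N) (x + lambda) ->
  z = mobius (S ^+ m * V j) x + lambda.
Proof.
rewrite /gen_pair /= => gj x0 [dig ones]; have lj : letter j by rewrite /letter; lia.
have jE : j = (j - 2).+2 by lia.
rewrite nonneg_mobiusM //; last exact: nonneg_diag_ge1_V.
rewrite (lcf_digit0_tail1 dig) mobius_SmxX (lcf_starts_ones_inv _ x0 ones); last by lia.
rewrite [in RHS]jE [in RHS]mobius_VS //; last by lia.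
by rewrite -natr1 -natr1; ring.
Qed.

Lemma lcf_starts_gen ps x : all gen_pair ps -> 0 < x ->
  lcf_starts (mobius (gen_prod ps) x + lambda) (cf_period ps) (x + lambda).
Proof.
move=> + x0; elim: ps => [_|[m j] ps IH /andP[gj gps]].
  by rewrite /Defs.gen_prod big_nil mobius1.
have nps := nonneg_gen_prod gps.
rewrite gen_prod_cons nonneg_mobiusM ?(ltW x0) //.
rewrite cf_period_cons; apply/lcf_starts_cat.
exists (mobius (gen_prod ps) x + lambda); last exact: IH.
exact/(lcf_starts_block gj)/nonneg_mobius_gt0.
Qed.

Lemma lcf_starts_gen_inv ps x z : all gen_pair ps -> 0 <= x ->
  lcf_starts z (cf_period ps) (x + lambda) -> z = mobius (gen_prod ps) x + lambda.
Proof.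
move=> + x0; elim: ps z => [z _ /= ->|[m j] ps IH z /andP[gj gps]].
  by rewrite /Defs.gen_prod big_nil mobius1.
have nps := nonneg_gen_prod gps.
rewrite cf_period_cons => /lcf_starts_cat[z' zz' /(IH _ gps) z'E].
rewrite z'E in zz'; rewrite gen_prod_cons nonneg_mobiusM //.
exact/lcf_starts_block_inv/zz'/nonneg_mobius_ge0.
Qed.

Lemma lcf_purely_periodic_ge ps z : (0 < size ps)%N ->
  lcf_purely_periodic p z (cf_period ps) -> lambda <= z.
Proof.
case: ps => // -[m j] ps _ [_ /(_ 0%N)]; rewrite mod0n /= => dig.
have /andP[lo _] := lcf_digit0_bounds dig.
have mE : (m.+2%:Z - 1 = m.+1%:Z)%R by rewrite -addn1 PoszD addrK.
rewrite mE -pmulrn -natr1 in lo.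
by have := mulr_ge0 (ler0n R m) (ltW lam_gt0); lra.
Qed.

Lemma lcf_purely_periodic_gen ps z : gen_word p ps -> 2 < \tr (gen_prod ps) ->
  lcf_purely_periodic p z (cf_period ps) <-> z = alpha_mx (gen_prod ps) + lambda.
Proof.
move=> [ps0 gps] trps; have nps := nonneg_gen_prod gps.
have detps := det_gen_prod ps; have posps := gen_prod_posmx gps trps.
have [_ fixal] := alpha_fixes detps trps (posmx_neq0 posps).
have al0 := alpha_gt0 detps trps posps; have [_ _ c0 _] := posps.
split=> [perz|->]; last first.
  apply: lcf_starts_self; first by case: (ps) ps0.
  by rewrite -{1}fixal; apply: lcf_starts_gen.
suff: z - lambda = alpha_mx (gen_prod ps) by lra.
apply: (mobius_expr_images_eq nps detps c0 (ltW al0) fixal) => n.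
have ge0 y : lcf_purely_periodic p y (cf_period ps) -> 0 <= y - lambda.
  by move/(lcf_purely_periodic_ge ps0); rewrite subr_ge0.
elim: n z perz => [|n IH] z perz.
  by exists (z - lambda); [exact: ge0 | rewrite expr0 mobius1].
have [z' zz' perz'] := lcf_purely_periodic_starts perz.
have [y y0 yE] := IH z' perz'.
exists y => //; rewrite exprS nonneg_mobiusM //; last exact: nonneg_diag_ge1X.
have := @lcf_starts_gen_inv ps (z' - lambda) z gps (ge0 _ perz').
by rewrite subrK -yE => /(_ zz') {1}->; rewrite addrK.
Qed.

Lemma alpha_translate M N q : S ^+ q * N = M * S ^+ q -> N 1 0 != 0 ->
  alpha_mx N = mobius (S ^- q) (alpha_mx M).
Proof.
rewrite mobius_SmxVX SmxX; set l := q%:R * lambda => /matrixP comm c0.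
have e00 := comm 0 0; have e10 := comm 1 0; have e11 := comm 1 1.
rewrite !mulmx_ord2E !mx2E in e00 e10 e11.
have E10 : M 1 0 = N 1 0 by lra.
have E00 : M 0 0 = N 0 0 + l * N 1 0 by lra.
have E11 : M 1 1 = N 1 1 - l * N 1 0 by rewrite E10 in e11; lra.
rewrite /alpha_mx E10 E00 E11.
have -> : N 0 0 + l * N 1 0 + (N 1 1 - l * N 1 0) = N 0 0 + N 1 1 by ring.
by field.
Qed.

Definition gen_beta ps (t : nat) : R := alpha_mx (gen_prod (rot t ps)) + lambda.

Lemma is_beta_gen_beta ps : gen_word p ps -> 2 < \tr (gen_prod ps) ->
  is_beta p ps (gen_beta ps).
Proof.
move=> [ps0 gps] trps t _ z; apply: lcf_purely_periodic_gen.
  by split; rewrite ?size_rot // (eq_all_r (mem_rot t ps)).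
by rewrite mxtrace_gen_prod_rot.
Qed.

Lemma alpha_gen_letters_rot ps t q : all gen_pair ps -> 2 < \tr (gen_prod ps) ->
  (t < size ps)%N -> (q <= (nth (0, 0)%N ps t).1)%N ->
  alpha_mx (Vprod (rot (flatten_index (block_sizes ps) t q) (gen_letters ps))) =
  mobius (S ^- q.+1) (gen_beta ps t).
Proof.
move=> gps trps tps qt.
have qsh : (q < nth 0 (block_sizes ps) t)%N by rewrite (nth_map (0, 0)%N).
set i := flatten_index _ _ _; set s := gen_letters (rot t ps).
have iE : i = (q + size (gen_letters (take t ps)))%N.
  by rewrite addnC size_gen_letters /block_sizes map_take.
have rotE : rot i (gen_letters ps) = rot q s.
  rewrite iE rotD ?gen_letters_rot // -iE size_gen_letters ltnW //.
  exact: flatten_indexP.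
have [r sE] : exists r, s = nseq q 1%N ++ r.
  move: qt; rewrite /s /rot (drop_nth (0, 0)%N tps); case: (nth _ ps t) => m j /= qm.
  exists (rcons (nseq (m - q) 1%N) j ++ gen_letters (drop t.+1 ps ++ take t ps)).
  by rewrite /gen_letters /= catA -rcons_cat -nseqD subnKC.
have transl : S ^+ q * Vprod (rot q s) = Vprod s * S ^+ q.
  by rewrite sE -{2}(size_nseq q 1%N) rot_size_cat !Vprod_cat Vprod_nseq Vmx1 mulrA.
have pos : posmx (Vprod (rot q s)).
  by rewrite -rotE; apply: posmx_Vprod_rot (gen_letters_letter gps) _;
    rewrite -gen_prod_letters.
rewrite rotE (alpha_translate transl (posmx_neq0 pos)) -gen_prod_letters.
by rewrite !mobius_SmxVX /gen_beta -natr1; ring.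
Qed.

Lemma Zset_gen_prod ps : gen_word p ps -> prim_hyp p (gen_prod ps) ->
  Zset p (bqf_class p (Qmx (gen_prod ps))) = shifted_betas p ps (gen_beta ps).
Proof.
move=> [ps0 gps] pps; have lps := gen_letters_letter gps.
have tr0 := gen_prod_trace_gt0 gps; have tr2 := prim_hyp_trace_gt2 pps tr0.
rewrite [in LHS]gen_prod_letters Zset_Vprod -?gen_prod_letters //.
apply/seteqP; split=> z /=.
  move=> [i]; rewrite size_gen_letters => ilt <-.
  have := reshape_indexP ilt; have := reshape_offsetP ilt; rewrite size_map.
  have := reshape_indexK (block_sizes ps) i.
  move: (reshape_index _ _) (reshape_offset _ _) => t q <- qt tps.
  rewrite (nth_map (0, 0)%N) // in qt.
  by exists t, q.+1; split; rewrite // alpha_gen_letters_rot.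
move=> [t [[|q] [tps qt ->]]] //.
exists (flatten_index (block_sizes ps) t q); last exact: alpha_gen_letters_rot.
by rewrite size_gen_letters; apply: flatten_indexP; rewrite (nth_map (0, 0)%N).
Qed.

End Hecke.

Theorem theorem3p3 (R : realType) (p : nat) (hp : (3 <= p)%N) :
  [/\
      forall C : set (set 'M[R]_2), prim_hyp_class p C ->
        hyperbolic_bqf_class p (forms_of p C) /\
        forall M : 'M[R]_2, C (pm M) -> 0 < \tr M ->
          forms_of p C = bqf_class p (Qmx M),
      set_bij (@prim_hyp_class R p) (@isp R p) (fun C => Pset p (forms_of p C))
    & forall (C : set (set 'M[R]_2)) (w : seq (nat * nat)),
        prim_hyp_class p C -> gen_word p w -> C (pm (gen_prod R p w)) ->
        exists2 beta : nat -> R, is_beta p w beta &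
          Zset p (forms_of p C) = shifted_betas p w beta /\
          [set z | Pset p (forms_of p C) z /\ 0 < z] = Zset p (forms_of p C)].
Proof.
split.
- move=> C /prim_hyp_class_rep[M [pM trM ->]]; split=> [|N MN trN].
    by rewrite forms_of_prim_hyp //; apply: hyperbolic_bqf_class_Qmx.
  exact: forms_of_conj_class.
- split.
  + move=> C /prim_hyp_class_rep[M [pM trM ->]]; rewrite forms_of_prim_hyp //.
    by exists (bqf_class p (Qmx M)); first exact: hyperbolic_bqf_class_Qmx.
  + move=> C D /set_mem/prim_hyp_class_rep[M [pM trM ->]].
    move=> /set_mem/prim_hyp_class_rep[N [pN trN ->]].
    rewrite !forms_of_prim_hyp // => PE.
    by apply: Zset_Qmx_inj => //; rewrite -!Pset_pos PE.
  + move=> P [A [Q [_ [M [pM trM ->]]] ->] ->].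
    by exists (conj_class p M); [exists M | rewrite forms_of_prim_hyp].
- move=> C w /prim_hyp_class_rep[M [pM trM ->]] gw Mw.
  have pw := prim_hyp_conj_class pM Mw; have trw := gen_prod_trace_gt0 R hp gw.2.
  exists (gen_beta R p w); first exact: is_beta_gen_beta gw (prim_hyp_trace_gt2 pw trw).
  by rewrite Pset_pos (forms_of_conj_class pM trM trw Mw) Zset_gen_prod.
Qed.
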